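(* Let $n$ be a positive integer, $\lambda>0$, $A\ge1$, $\rho\in(0,1]$ with $\rho n$ an integer, and let $x\in\mathbb{R}^n$ be an arbitrary $(\rho,A)$-sparse vector. Let $Y$ be drawn from the planted spiked Wigner model $\mathbb{P}_n$ with signal $x$. Suppose $$\rho \le \frac{\lambda^2}{338A^4}\frac{1}{\log n},$$ and let $\ell$ be any (positive) integer in the interval $$\ell \in \left[\frac{338 A^4}{\lambda^2}\rho^2 n\log n,\; \rho n\right]$$ (which is nonempty by the assumption on $\rho$). Then the output $\bar x$ of the Wigner recovery algorithm (defined in the context), run with parameters $\rho,\lambda,A,\ell$, satisfies $$1-\mathbb{P}_n\left[\mathrm{supp}(\bar{x}) = \mathrm{supp}(x),\ \mathrm{sign}(\bar{x}) = \pm\, \mathrm{sign}(x)\right]\le 4\exp\left(-\frac{\lambda^2}{288A^4}\frac{\ell}{\rho^2 n}\right)\le 4n^{-169/144}.$$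
   Context: A vector $x\in\mathbb{R}^n$ is $(\rho,A)$-sparse (for $\rho\in(0,1]$, $A\ge1$, $\rho n$ an integer) if $\|x\|_2=1$, $\|x\|_0=|\mathrm{supp}(x)|=\rho n$, and $\frac{1}{A\sqrt{\rho n}}\le |x_i|\le \frac{A}{\sqrt{\rho n}}$ for every $i\in\mathrm{supp}(x)=\{i: x_i\ne0\}$. $\mathsf{GOE}(n)$ is the law of a random symmetric $n\times n$ matrix $W$ with entries independent up to symmetry, $W_{ii}\sim\mathcal{N}(0,2/n)$ and $W_{ij}=W_{ji}\sim\mathcal{N}(0,1/n)$ for $i<j$. Planted spiked Wigner model $\mathbb{P}_n$ (parameters $n,\lambda$, signal $x$): one observes $Y=W+\lambda xx^\top$ with $W\sim\mathsf{GOE}(n)$. For a vector $u$, $\mathrm{sign}(u)$ is the vector with entries $\mathrm{sign}(u_i)\in\{1,-1,0\}$ according to whether $u_i>0$, $u_i<0$, $u_i=0$. $\mathrm{sign}(\bar x)=\pm\,\mathrm{sign}(x)$ means $\mathrm{sign}(\bar x)=\mathrm{sign}(x)$ or $\mathrm{sign}(\bar x)=-\mathrm{sign}(x)$. Wigner recovery algorithm. Input: $Y$ and parameters $\rho,\lambda,A$, and a positive integer $\ell$. (1) Sample $\tilde W\sim\mathsf{GOE}(n)$ independently of $Y$. (2) Let $Y'=(Y+\tilde W)/\sqrt2$ and $Y''=(Y-\tilde W)/\sqrt2$. (3) Let $\mathcal{I}_{n,\ell}=\{v\in\{-1,0,1\}^n:\|v\|_0=\ell\}$. (4) Let $v^*\in\mathrm{argmax}_{v\in\mathcal{I}_{n,\ell}}v^\top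 Y'v$ (a maximizer chosen as a function of $Y'$). (5) Let $z=Y''v^*$. (6) With $\bar\lambda=\lambda/\sqrt2$, for $j=1,\dots,n$ set $\bar x_j=\mathrm{sign}(z_j)\cdot\mathbf{1}\{|z_j|>\frac{\bar\lambda\ell}{4A^2\rho n}\}$. Output $\bar x$. The probability $\mathbb{P}_n$ also includes the randomness of $\tilde W$. *)

(* Defs.v *)
From HB Require Import structures.
From mathcomp Require Import all_boot all_order all_algebra.
From mathcomp Require Import all_classical all_reals all_analysis.
Set Implicit Arguments.
Unset Strict Implicit.
Unset Printing Implicit Defensive.
Import Order.TTheory GRing.Theory Num.Theory.
Import numFieldNormedType.Exports.

Local Open Scope classical_set_scope.
Local Open Scope ring_scope.

(* Matrices carry the product sigma-algebra, generated by the coordinate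
   maps M |-> M i j. *)
Section measurable_matrix.
Context {d : measure_display} {T : measurableType d}.
Variables m n : nat.

Definition mx_cylinder : set (set 'M[T]_(m, n)) :=
  [set C | exists i j (B : set T),
    measurable B /\ C = [set M : 'M[T]_(m, n) | B (M i j)]].

HB.instance Definition _ := @isMeasurable.Build (sigma_display mx_cylinder)
  'M[T]_(m, n) <<s mx_cylinder >>
  (@sigma_algebra0 _ setT mx_cylinder)
  (@sigma_algebraC _ mx_cylinder)
  (@sigma_algebra_bigcup _ setT mx_cylinder).

End measurable_matrix.

Section probability_notions.
Context {d : measure_display} {T : measurableType d} {R : realType}.
Variable P : probability T R.

Definition mutually_independent (I : finType) (X : I -> T -> R) : Prop :=
  forall (J : {set I}) (B : I -> set R), (forall i, measurable (B i)) ->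
    P (\bigcap_(i in [set` J]) (X i @^-1` B i)) =
    (\prod_(i in J) P (X i @^-1` B i))%E.

Definition independent_RV {d1 d2 : measure_display} {T1 : measurableType d1}
    {T2 : measurableType d2} (X : {RV P >-> T1}) (Y : {RV P >-> T2}) : Prop :=
  forall (B : set T1) (C : set T2), measurable B -> measurable C ->
    P ((X @^-1` B) `&` (Y @^-1` C)) = (P (X @^-1` B) * P (Y @^-1` C))%E.

(* [normal_prob] takes the standard deviation, hence the square root. *)
Definition centered_normal (X : T -> R) (variance : R) : Prop :=
  forall B : set R, measurable B ->
    P (X @^-1` B) = normal_prob 0 (Num.sqrt variance) B.

Definition GOE (n : nat) (W : {RV P >-> 'M[R]_n}) : Prop :=
  [/\ forall t, (W t)^T = W t,
      mutually_independent
        (fun (k : {ij : 'I_n * 'I_n | (ij.1 <= ij.2)%N}) t =>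
           W t (val k).1 (val k).2),
      forall i, centered_normal (fun t => W t i i) (2 / n%:R) &
      forall i j : 'I_n, (i < j)%N ->
        centered_normal (fun t => W t i j) (1 / n%:R)].

Definition spiked_wigner (n : nat) (lambda : R) (x : 'cV[R]_n)
    (Y : {RV P >-> 'M[R]_n}) : Prop :=
  exists W : {RV P >-> 'M[R]_n},
    GOE W /\ forall t, Y t = W t + lambda *: (x *m x^T).

End probability_notions.

Section vectors.
Context {R : realType}.
Variable n : nat.
Implicit Types (v x : 'cV[R]_n) (M : 'M[R]_n).

Definition supp v : {set 'I_n} := [set i | v i 0 != 0].

Definition l2norm v : R := Num.sqrt (\sum_i v i 0 ^+ 2).

Definition sign_vec v : 'cV[R]_n := map_mx Num.sg v.

Definition sparse (rho A : R) x : Prop :=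
  [/\ l2norm x = 1,
      #|supp x|%:R = rho * n%:R &
      forall i, i \in supp x ->
        1 / (A * Num.sqrt (rho * n%:R)) <= `|x i 0|
          <= A / Num.sqrt (rho * n%:R)].

Definition ternary_vectors (l : nat) : set 'cV[R]_n :=
  [set v : 'cV[R]_n | (forall i, v i 0 \in [:: -1; 0; 1]) /\ #|supp v| = l].

Definition quad_form M v : R := (v^T *m M *m v) 0 0.

Definition argmax (V : Type) (D : set V) (f : V -> R) : set V :=
  [set v | D v /\ forall u, D u -> f u <= f v].

(* Measurability of the selection is what makes the output of the algorithm a
   random variable; ties always occur, since v and - v have the same value. *)
Definition argmax_selection (l : nat) (vstar : 'M[R]_n -> 'cV[R]_n) : Prop :=
  measurable_fun setT vstar /\
  forall M, argmax (ternary_vectors l) (quad_form M) (vstar M).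

Definition wigner_recovery (rho lambda A : R) (l : nat)
    (vstar : 'M[R]_n -> 'cV[R]_n) (Y Wt : 'M[R]_n) : 'cV[R]_n :=
  let Y1 := (Num.sqrt 2)^-1 *: (Y + Wt) in
  let Y2 := (Num.sqrt 2)^-1 *: (Y - Wt) in
  let z := Y2 *m vstar Y1 in
  let lambda_bar := lambda / Num.sqrt 2 in
  \col_j (Num.sg (z j 0) *
    (lambda_bar * l%:R / (4 * A ^+ 2 * rho * n%:R) < `|z j 0|)%R%:R).

Definition exact_recovery x xbar : Prop :=
  supp xbar = supp x /\
  (sign_vec xbar = sign_vec x \/ sign_vec xbar = - sign_vec x).

Definition ell_range (rho lambda A : R) : interval R :=
  `[338 * A ^+ 4 / lambda ^+ 2 * rho ^+ 2 * n%:R * ln n%:R, rho * n%:R].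

End vectors.

Arguments ell_range {R} n rho lambda A.

(* Main.v *)
From HB Require Import structures.
Require Import Defs.
From mathcomp Require Import all_boot all_order all_algebra.
From mathcomp Require Import all_classical all_reals all_analysis.
From mathcomp Require Import measurable_realfun ring lra.
Import Order.TTheory GRing.Theory Num.Theory.
Import numFieldNormedType.Exports.
Local Open Scope classical_set_scope.
Local Open Scope ring_scope.

(** Write [k = rho n] for the size of the support, [lb = lambda / sqrt 2],
    [W1 = (W + Wt) / sqrt 2] and [W2 = (W - Wt) / sqrt 2], so that
    [Y' = W1 + lb x x^T] and [Y'' = W2 + lb x x^T], and let
    [snr = lambda^2 l / (A^4 rho^2 n)], which is at least [338 log n].

    Stage 1. The sign pattern [v0] of [x] on [l] points of its support satisfies
    [<v0, x> >= l / (A sqrt k)]. A ternary vector [v] with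
    [|<v, x>| < l / (2 A sqrt k)] beats it only if the Gaussian variable
    [v^T W1 v - v0^T W1 v0], of variance at most [4 l^2 / n], exceeds
    [s = (3/4) lb l^2 / (A^2 k)]. This has probability at most
    [exp (- 9/256 l snr)], which absorbs the union bound over at most [(2 n)^l]
    vectors [v].

    Stage 2. Given the selected vector [v], the entry [z_j] equals
    [lb <v, x> x_j + (W2 v)_j], whose signal part is at least twice the threshold
    [tau] on the support of [x] and zero outside. As [W2] is independent of [W1],
    hence of [v], some entry of [W2 v] exceeds [tau] in absolute value with
    probability at most [2 n exp (- snr / 128)]. Each stage thus fails with
    probability at most [2 exp (- snr / 288)], and otherwise thresholding [z]
    recovers the support of [x], and its signs up to the sign of [<v, x>]
    ([exact_recovery_cover], [exact_recovery_threshold]).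

    Both Gaussian tails, and the independence of [W1] and [W2], come from one
    formula of Cameron-Martin type: weighting the law of [(W, Wt)] by
    [exp (<M, W> + <M', Wt>)] translates it by [((2/n) M, (2/n) M')], up to the
    factor [exp ((|M|^2 + |M'|^2) / n)] ([GOE_pair_tilt]). The weight
    [exp (th <M, W2>)] is of this form with opposite translations, so that it
    leaves every event about [W + Wt] unchanged, and Markov's inequality then
    bounds the probability of [<M, W2> >= u] jointly with such an event
    ([GOE_pair_chernoff]). The formula itself ([cameron_martin]) is checked on
    rectangles, where it reduces by independence to the tilting of
    one-dimensional Gaussian laws ([expectation_prod_independent],
    [integral_normal_tilt]), and extends to all events because rectangles
    generate the product sigma-algebra. *)

(** * Densities *)

Section density.
Local Open Scope ereal_scope.
Context {d : measure_display} {T : measurableType d} {R : realType}.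
Variables (mu : {measure set T -> \bar R}) (h : T -> R).
Hypotheses (mh : measurable_fun setT h) (h0 : forall t, (0 <= h t)%R).

Let hE0 t : 0 <= (h t)%:E. Proof. by rewrite lee_fin. Qed.
Let mhE : measurable_fun setT (fun t => (h t)%:E : \bar R).
Proof. exact/measurable_EFinP. Qed.

(** The measure with density [h] with respect to [mu]. Measurability and
    nonnegativity of [h] are arguments of the function, although its value does
    not depend on them, so that its measure structure can be inferred. *)
Definition mdensity of measurable_fun setT h & (forall t, (0 <= h t)%R) :=
  fun A : set T => \int[mu]_(t in A) (h t)%:E.

Notation nu := (mdensity mh h0).

Let mdensity0 : nu set0 = 0. Proof. exact: integral_set0. Qed.

Let mdensity_ge0 A : 0 <= nu A.
Proof. by apply: integral_ge0 => t _. Qed.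

Let mdensity_sigma_additive : semi_sigma_additive nu.
Proof.
move=> F mF tF mUF; rewrite /mdensity ge0_integral_bigcup//; last first.
  exact: measurable_funTS.
by apply: is_cvg_ereal_nneg_natsum_cond => n _ _; exact: integral_ge0.
Qed.

HB.instance Definition _ := isMeasure.Build _ _ _
  nu mdensity0 mdensity_ge0 mdensity_sigma_additive.

Import HBNNSimple.

Lemma ge0_integral_mdensity (f : T -> \bar R) :
    measurable_fun setT f -> (forall t, 0 <= f t) ->
  \int[nu]_t f t = \int[mu]_t (f t * (h t)%:E).
Proof.
move=> mf f0; pose g := nnsfun_approx measurableT mf.
have gf t : (EFin \o g n) t @[n --> \oo] --> f t.
  exact: cvg_nnsfun_approx.
have nd_g t a b : (a <= b)%N -> (EFin \o g a) t <= (EFin \o g b) t.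
  by move=> ab; rewrite lee_fin; exact/lefP/nd_nnsfun_approx.
have mg n : measurable_fun setT (EFin \o g n).
  exact/measurable_EFinP/measurable_funP.
transitivity (lim (\int[nu]_t (EFin \o g n) t @[n --> \oo])).
  rewrite -monotone_convergence//.
  - by apply: eq_integral => t _; apply/esym/cvg_lim.
  - by move=> n t _; rewrite lee_fin.
  - by move=> t _ a b; exact: nd_g.
transitivity (lim (\int[mu]_t ((EFin \o g n) t * (h t)%:E) @[n --> \oo])); last first.
  rewrite -monotone_convergence//.
  - by apply: eq_integral => t _; apply/cvg_lim => //; exact: cvgeZr.
  - by move=> n; exact: emeasurable_funM.
  - by move=> n t _; rewrite mule_ge0 ?lee_fin.
  - by move=> t _ a b ab; rewrite lee_wpmul2r// nd_g.
congr (lim _); apply: congr2 => //; apply/funext => n.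
have E t : (EFin \o g n) t =
    \sum_(y \in range (g n)) (y * \1_(g n @^-1` [set y]) t)%:E.
  by rewrite /= fimfunE -fsumEFin.
have Eh t : (EFin \o g n) t * (h t)%:E =
    \sum_(y \in range (g n)) ((y * \1_(g n @^-1` [set y]) t)%:E * (h t)%:E).
  by rewrite E ge0_mule_fsuml// => y; exact: nnfun_muleindic_ge0.
under [LHS]eq_integral do rewrite E.
under [RHS]eq_integral do rewrite Eh.
rewrite ge0_integral_fsum//; last 2 first.
- by move=> y; apply/measurable_EFinP; exact: measurable_funM.
- by move=> y t _; exact: nnfun_muleindic_ge0.
rewrite ge0_integral_fsum//; last 2 first.
- move=> y; apply: emeasurable_funM => //.
  by apply/measurable_EFinP; exact: measurable_funM.
- by move=> y t _; rewrite mule_ge0 ?nnfun_muleindic_ge0.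
apply: eq_fsbigr => y /[!inE] -[t0 _ <-].
rewrite integralZl_indic_nnsfun// integral_indic// setIT.
under eq_integral do rewrite EFinM -muleA.
rewrite ge0_integralZl//; last 3 first.
- by apply: emeasurable_funM => //; exact/measurable_EFinP.
- by move=> t _; rewrite mule_ge0 ?lee_fin.
- by rewrite lee_fin.
congr (_ * _).
transitivity (\int[mu]_(t in g n @^-1` [set g n t0]) (h t)%:E) => //.
rewrite integral_mkcond; apply: eq_integral => t _.
by rewrite epatch_indic muleC.
Qed.

End density.

(** Integration of a function of [X] against a weight [h] whose integrals over
    the events determined by [X] are proportional to their measures; this is how
    the independence of [X] from other factors is used. *)
Lemma ge0_integral_weightM {d : measure_display} {T : measurableType d}
    {R : realType} (mu : {measure set T -> \bar R}) (h : T -> R) (X : T -> R)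
    (c : R) (f : R -> R) :
    measurable_fun setT h -> (forall t, 0 <= h t) ->
    measurable_fun setT X -> 0 <= c ->
    measurable_fun setT f -> (forall y, 0 <= f y) ->
    (forall B, measurable B ->
      (\int[mu]_(t in X @^-1` B) (h t)%:E = c%:E * mu (X @^-1` B))%E) ->
  (\int[mu]_t (f (X t) * h t)%:E = c%:E * \int[mu]_t (f (X t))%:E)%E.
Proof.
move=> mh h0 mX c0 mf f0 hX.
have mfE : measurable_fun setT (EFin \o f) by exact/measurable_EFinP.
have mfXE : measurable_fun setT (fun t => (f (X t))%:E : \bar R).
  by apply/measurable_EFinP; exact: measurableT_comp.
under eq_integral do rewrite EFinM.
rewrite -(ge0_integral_mdensity mu _ mh h0 (fun t => (f (X t))%:E)%E)//; last first.
  by move=> t; rewrite lee_fin.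
have fE0 : {in [set: R], forall y, (0 <= (EFin \o f) y)%E}.
  by move=> y _; rewrite lee_fin.
rewrite -[LHS](ge0_integral_pushforward mX (mdensity mu _ mh h0) measurableT mfE fE0).
rewrite -[in RHS](ge0_integral_pushforward mX mu measurableT mfE fE0).
rewrite -(ge0_integral_mscale _ _ (NngNum c0))//=; last by move=> y _; rewrite lee_fin.
by apply: eq_measure_integral => B mB _; exact: hX.
Qed.

(** * Gaussian laws on the line *)

Lemma lebesgue_measure_shift {R : realType} (a : R) (A : set R) :
  measurable A ->
  pushforward lebesgue_measure (+%R^~ a : R -> measurableTypeR R) A =
  lebesgue_measure A.
Proof.
have ma : measurable_fun setT (+%R^~ a : R -> measurableTypeR R).
  exact: measurable_funD.
move=> mA; apply/esym/lebesgue_measure_unique => //= _ [[u v]] _ <-.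
rewrite /pushforward.
have -> : (+%R^~ a : R -> measurableTypeR R) @^-1` `]u, v] = `]u - a, v - a]%classic.
  by apply/seteqP; split => y /=; rewrite !in_itv/= ltrBlDr lerBrDr.
rewrite !lebesgue_measure_itv/= !lte_fin ltrD2r -!EFinD.
by case: ifP => // _; congr EFin; ring.
Qed.

Lemma normal_prob_shift {R : realType} (a s : R) (B : set R) :
    s != 0 -> measurable B ->
  normal_prob 0 s (+%R^~ a @^-1` B) = normal_prob a s B.
Proof.
move=> s0 mB; rewrite /normal_prob.
have ma : measurable_fun setT (+%R^~ a : R -> measurableTypeR R).
  exact: measurable_funD.
transitivity (\int[pushforward lebesgue_measure
    (+%R^~ a : R -> measurableTypeR R)]_(y in B) (normal_pdf a s y)%:E)%E.
  rewrite ge0_integral_pushforward//.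
  - apply: eq_integral => y _ /=; congr EFin.
    by rewrite !normal_pdfE// /normal_fun subr0 addrK.
  - by apply/measurable_EFinP/measurable_funTS; exact: measurable_normal_pdf.
  - by move=> y _; rewrite lee_fin normal_pdf_ge0.
by apply: eq_measure_integral => C mC _; exact: lebesgue_measure_shift.
Qed.

(** One-dimensional exponential tilting: weighting the law N(0, s^2) by
    [exp (a y - a^2 s^2 / 2)] translates it by [a s^2]. *)
Lemma integral_normal_tilt {d : measure_display} {T : measurableType d}
    {R : realType} (P : probability T R) (X : T -> R) (s a : R) (B : set R) :
    s != 0 -> measurable_fun setT X ->
    (forall C, measurable C -> P (X @^-1` C) = normal_prob 0 s C) ->
    measurable B ->
  (\int[P]_t (\1_B (X t) * expR (a * X t - a ^+ 2 * s ^+ 2 / 2))%:E =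
   P ((fun t => X t + a * s ^+ 2)%R @^-1` B))%E.
Proof.
move=> s0 mX lawX mB.
have mBa : measurable (+%R^~ (a * s ^+ 2) @^-1` B : set R).
  by rewrite -[X in measurable X]setTI; exact: measurable_funD.
rewrite (_ : _ @^-1` B = X @^-1` (+%R^~ (a * s ^+ 2) @^-1` B))// lawX//.
rewrite normal_prob_shift//.
pose f (y : R) := \1_B y * expR (a * y - a ^+ 2 * s ^+ 2 / 2).
have mf : measurable_fun setT f.
  apply: measurable_funM; first exact: measurable_indic.
  apply: measurableT_comp => //; exact: measurable_funB.
have f0 y : 0 <= f y by rewrite mulr_ge0 ?expR_ge0// indicE.
(* The Lebesgue measure lives on the copy [measurableTypeR R] of [R]. *)
have mX' : measurable_fun setT (X : T -> measurableTypeR R) by exact: mX.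
have mfE : measurable_fun setT (EFin \o f : measurableTypeR R -> \bar R).
  exact/measurable_EFinP.
have fE0 : {in [set: measurableTypeR R], forall y, (0 <= (EFin \o f) y)%E}.
  by move=> y _; rewrite lee_fin.
rewrite -[LHS](ge0_integral_pushforward mX' P measurableT mfE fE0).
have mpdf : measurable_fun setT (normal_pdf 0 s : measurableTypeR R -> R).
  exact: measurable_normal_pdf.
have pdf0 y : 0 <= normal_pdf 0 s y by exact: normal_pdf_ge0.
rewrite (eq_measure_integral (mdensity lebesgue_measure _ mpdf pdf0)); last first.
  by move=> C mC _; exact: lawX.
rewrite ge0_integral_mdensity//.
rewrite /normal_prob [RHS]integral_mkcond; apply: eq_integral => y _ /=.
rewrite patchE /f indicE; case: (y \in B); last by rewrite mul0r mul0e.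
rewrite mul1r -EFinM; congr EFin; rewrite !normal_pdfE// /normal_fun.
rewrite mulrCA -expRD; congr (_ * expR _).
by field.
Qed.

(** * Independent families and the Cameron-Martin formula *)

(** The product formula for the expectations of functions of independent
    variables. The factors are replaced one at a time, starting from indicator
    functions, for which the formula is the definition of independence. *)
Lemma expectation_prod_independent {d : measure_display}
    {T : measurableType d} {R : realType} (P : probability T R) (I : finType)
    (X : I -> T -> R) (g : I -> R -> R) (c : I -> R) :
    (forall i, measurable_fun setT (X i)) -> mutually_independent P X ->
    (forall i, measurable_fun setT (g i)) -> (forall i y, 0 <= g i y) ->
    (forall i, (\int[P]_t (g i (X i t))%:E = (c i)%:E)%E) ->
  (\int[P]_t (\prod_i g i (X i t))%:E = (\prod_i c i)%:E)%E.
Proof.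
move=> mX indX.
suff H (s : seq I) : forall (g : I -> R -> R) (c : I -> R),
    (forall i, measurable_fun setT (g i)) -> (forall i y, 0 <= g i y) ->
    (forall i, (\int[P]_t (g i (X i t))%:E = (c i)%:E)%E) ->
    (forall i, i \notin s -> exists2 B, measurable B & g i = \1_B) ->
    (\int[P]_t (\prod_i g i (X i t))%:E = (\prod_i c i)%:E)%E.
  by move=> mg g0 gc; apply: (H (index_enum I)) => // i; rewrite mem_index_enum.
elim: s => [|k s IH] {}g {}c mg g0 gc gs.
  have /choice[B mB] : forall i, exists B, measurable B /\ g i = \1_B.
    by move=> i; have [//|B ? ?] := gs i; exists B.
  have mXB i : measurable (X i @^-1` B i).
    by rewrite -[X in measurable X]setTI; apply: mX => //; exact: (mB i).1.
  have cB i : (c i)%:E = P (X i @^-1` B i).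
    rewrite -gc -[X in P X]setIT -integral_indic//.
    by apply: eq_integral => t _; rewrite (mB i).2.
  transitivity (P (\bigcap_(i in [set` [set: I]%SET]) (X i @^-1` B i))).
    rewrite -[X in P X]setIT -integral_indic//; last first.
      by apply: fin_bigcap_measurable => //; exact: finite_finset.
    apply: eq_integral => t _; congr EFin.
    under eq_bigr do rewrite (mB _).2.
    rewrite [RHS]indicE; case: (boolP (t \in _)) => [|/negP tB].
      rewrite inE => tB; rewrite big1// => i _.
      by rewrite indicE mem_set//; apply: (tB i); rewrite /= inE.
    have [i tBi] : exists i, ~ B i (X i t).
      apply/existsNP => H; apply: tB; rewrite inE => i _; exact: H.
    by rewrite (bigD1 i)//= indicE memNset// mul0r.
  rewrite indX; last by move=> i; exact: (mB i).1.
  rewrite (eq_bigr (fun i => (c i)%:E)) => [|i _]; last by rewrite cB.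
  rewrite prodEFin; congr EFin; apply: eq_bigl => i; by rewrite inE.
pose h t := \prod_(i | i != k) g i (X i t).
have mh : measurable_fun setT h.
  apply: (eq_measurable_fun (fun t =>
      \prod_i (if i != k then g i (X i t) else 1))) => [t _|].
    by rewrite /h [RHS]big_mkcond.
  by apply: measurable_prod => i _; case: (i != k) => //; exact: measurableT_comp.
have h0 t : 0 <= h t by exact: prodr_ge0.
have c0 i : 0 <= c i.
  by rewrite -lee_fin -gc; apply: integral_ge0 => t _; rewrite lee_fin.
transitivity (\int[P]_t (g k (X k t) * h t)%:E)%E.
  by apply: eq_integral => t _; rewrite (bigD1 k).
rewrite (ge0_integral_weightM P h (X k) (\prod_(i | i != k) c i) (g k))//.
- by rewrite gc -EFinM [in RHS](bigD1 k)//= mulrC.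
- exact: prodr_ge0.
(* With the indicator of [B] in place of [g k], the induction hypothesis gives the
   weight of [X k @^-1` B]. *)
move=> B mB.
have mXB : measurable (X k @^-1` B).
  by rewrite -[X in measurable X]setTI; exact: mX.
have fP : P (X k @^-1` B) \is a fin_num by exact: fin_num_measure.
transitivity (\int[P]_t (\prod_i (if i == k then \1_B else g i) (X i t))%:E)%E.
  rewrite integral_mkcond; apply: eq_integral => t _.
  rewrite (bigD1 k)//= eqxx patchE indicE.
  have -> : (t \in X k @^-1` B) = (X k t \in B) by apply/idP/idP; rewrite !inE.
  rewrite (eq_bigr (fun i => g i (X i t))) => [|i /negbTE->//].
  by case: (X k t \in B); rewrite ?mul1r ?mul0r.
rewrite (IH (fun i => if i == k then \1_B else g i)
    (fun i => if i == k then fine (P (X k @^-1` B)) else c i)).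
- rewrite (bigD1 k)//= eqxx (eq_bigr c) => [|i /negbTE->//].
  by rewrite mulrC EFinM fineK.
- by move=> i; case: eqP => // _; exact: measurable_indic.
- by move=> i y; case: eqP => // _; rewrite indicE.
- move=> i; case: eqP => [->|//]; rewrite fineK//.
  by rewrite -[X in _ = P X]setIT -integral_indic.
- move=> i is'; case: eqP => [_|/eqP ik]; first by exists B.
  by apply: gs; rewrite inE negb_or ik.
Qed.

Lemma measurable_mx_coord {d : measure_display} {T : measurableType d}
    (m n : nat) (i : 'I_m) (j : 'I_n) :
  measurable_fun [set: 'M[T]_(m, n)] (fun M => M i j).
Proof.
move=> _ B mB; rewrite setTI; apply: sub_sigma_algebra.
by exists i, j, B.
Qed.

Lemma measurable_mxP {d d' : measure_display} {T : measurableType d}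
    {U : measurableType d'} (m n : nat) (f : U -> 'M[T]_(m, n)) :
  (forall i j, measurable_fun setT (fun u => f u i j)) -> measurable_fun setT f.
Proof.
move=> mf; apply: (measurability (@mx_cylinder d T m n)) => //.
move=> _ [_ [i [j [B [mB ->]]]] <-].
exact: mf.
Qed.

(** Two image measures that agree on a generating pi-system containing the whole
    space are equal, provided that their mass is finite. *)
Lemma pushforward_unique {d d' : measure_display} {T : measurableType d}
    {V : measurableType d'} {R : realType} (mu nu : {measure set T -> \bar R})
    (f g : T -> V) (G : set (set V)) :
    measurable = <<s G >> -> setI_closed G -> G setT ->
    measurable_fun setT f -> measurable_fun setT g -> (mu setT < +oo)%E ->
    (forall A, G A -> mu (f @^-1` A) = nu (g @^-1` A)) ->
  forall A, measurable A -> mu (f @^-1` A) = nu (g @^-1` A).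
Proof.
move=> mG GI GT mf mg muT mfg A mA.
unshelve refine (@measure_unique _ _ _ G (fun=> setT) mG GI _ _
  (pushforward mu f) (pushforward nu g) mfg _ A mA) => //.
by rewrite bigcup_const.
Qed.

Lemma mutually_independent_comp {d : measure_display} {T : measurableType d}
    {R : realType} (P : probability T R) (I : finType) (X : I -> T -> R)
    (f : I -> R -> R) :
  (forall i, measurable_fun setT (f i)) -> mutually_independent P X ->
  mutually_independent P (fun i t => f i (X i t)).
Proof.
move=> mf indX J B mB; apply: (indX J (fun i => f i @^-1` B i)) => i.
by rewrite -[X in measurable X]setTI; exact: mf.
Qed.

(** The measurable rectangles of a space of matrices. *)
Definition mx_rectangle {d : measure_display} {T : measurableType d} (m n : nat)
    : set (set 'M[T]_(m, n)) :=
  [set C | exists2 B : 'I_m -> 'I_n -> set T, (forall i j, measurable (B i j)) &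
    C = [set M : 'M[T]_(m, n) | forall i j, B i j (M i j)]].

Lemma measurable_mx_rectangle {d : measure_display} {T : measurableType d}
    (m n : nat) (C : set 'M[T]_(m, n)) : mx_rectangle m n C -> measurable C.
Proof.
move=> [B mB ->].
have -> : [set M : 'M[T]_(m, n) | forall i j, B i j (M i j)] =
    \bigcap_(k in [set: 'I_m * 'I_n]) (fun M => M k.1 k.2) @^-1` B k.1 k.2.
  by apply/seteqP; split => [M MB [i j] _|M MB i j]; [exact: MB|exact: (MB (i, j))].
apply: fin_bigcap_measurable => [|[i j] _ /=]; first exact: finite_finset.
by rewrite -[X in measurable X]setTI; exact: measurable_mx_coord.
Qed.

Lemma mx_rectangleI {d : measure_display} {T : measurableType d} (m n : nat) :
  setI_closed (@mx_rectangle d T m n).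
Proof.
move=> _ _ [B mB ->] [B' mB' ->]; exists (fun i j => B i j `&` B' i j).
  by move=> i j; exact: measurableI.
apply/seteqP; split => [M [MB MB'] i j|M MB]; first by split.
by split => i j; case: (MB i j).
Qed.

Lemma mx_rectangleT {d : measure_display} {T : measurableType d} (m n : nat) :
  @mx_rectangle d T m n setT.
Proof. by exists (fun _ _ => setT) => //; apply/seteqP; split. Qed.

Lemma g_sigma_mx_rectangle {d : measure_display} {T : measurableType d}
    (m n : nat) :
  @measurable _ 'M[T]_(m, n) = <<s @mx_rectangle d T m n >>.
Proof.
apply/seteqP; split; last first.
  apply: smallest_sub; first exact: sigma_algebra_measurable.
  by move=> C; exact: measurable_mx_rectangle.
apply: smallest_sub; first exact: smallest_sigma_algebra.
move=> _ [i [j [B [mB ->]]]]; apply: sub_sigma_algebra.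
exists (fun i' j' => if (i' == i) && (j' == j) then B else setT).
  by move=> i' j'; case: ifP.
apply/seteqP; split => [M /= MB i' j'|M /= /(_ i j)]; last by rewrite !eqxx.
by case: ifP => // /andP[/eqP-> /eqP->].
Qed.

(** A finite family packed in a row vector; this equips the space of its values
    with the product sigma-algebra. *)
Definition family_row {R : realType} {I : finType} (x : I -> R) : 'rV[R]_#|I| :=
  \row_(k < #|I|) x (enum_val k).

Lemma measurable_family_row {d : measure_display} {T : measurableType d}
    {R : realType} (I : finType) (X : I -> T -> R) :
  (forall i, measurable_fun setT (X i)) ->
  measurable_fun setT (fun t => family_row (X^~ t)).
Proof.
move=> mX; apply: measurable_mxP => i j.
rewrite (_ : (fun t => _) = X (enum_val j)); first exact: mX.
by apply/funext => t; rewrite mxE.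
Qed.

(** The Cameron-Martin formula for a finite family of independent centered
    Gaussian variables. *)
Lemma cameron_martin {d : measure_display} {T : measurableType d}
    {R : realType} (P : probability T R) (I : finType) (X : I -> T -> R)
    (s a : I -> R) (S : set 'rV[R]_#|I|) :
    (forall i, s i != 0) -> (forall i, measurable_fun setT (X i)) ->
    mutually_independent P X ->
    (forall i C, measurable C -> P (X i @^-1` C) = normal_prob 0 (s i) C) ->
    measurable S ->
  (\int[P]_(t in (fun t => family_row (X^~ t)) @^-1` S)
    (expR (\sum_i (a i * X i t - a i ^+ 2 * s i ^+ 2 / 2)))%:E =
   P ((fun t => family_row (fun i => X i t + a i * s i ^+ 2)%R) @^-1` S))%E.
Proof.
move=> s0 mX indX lawX mS.
pose h t := expR (\sum_i (a i * X i t - a i ^+ 2 * s i ^+ 2 / 2)).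
have mh : measurable_fun setT h.
  apply: measurableT_comp => //; apply: measurable_sum => i.
  by apply: measurable_funB => //; exact: measurable_funM.
have h0 t : 0 <= h t by exact: expR_ge0.
have hE t : h t = \prod_i expR (a i * X i t - a i ^+ 2 * s i ^+ 2 / 2).
  by rewrite /h expR_sum.
have mXs i : measurable_fun setT (fun t => X i t + a i * s i ^+ 2).
  exact: measurable_funD.
have key (C : I -> set R) : (forall i, measurable (C i)) ->
    (\int[P]_(t in [set t | forall i, C i (X i t)]) (h t)%:E =
     P [set t | forall i, C i (X i t + a i * s i ^+ 2)%R])%E.
  move=> mC.
  pose Z i t := X i t + a i * s i ^+ 2.
  have indZ : mutually_independent P Z.
    apply: (mutually_independent_comp P I X (fun i => +%R^~ (a i * s i ^+ 2))) => //.
    by move=> i; exact: measurable_funD.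
  have mZC i : measurable (Z i @^-1` C i).
    by rewrite -[X in measurable X]setTI; exact: mXs.
  have -> : [set t | forall i, C i (X i t + a i * s i ^+ 2)] =
      \bigcap_(i in [set` [set: I]%SET]) (Z i @^-1` C i).
    apply/seteqP; split => t H i; first by move=> _; exact: H.
    by apply: (H i); rewrite /= inE.
  rewrite indZ//.
  transitivity (\int[P]_t (\prod_i
      (\1_(C i) (X i t) * expR (a i * X i t - a i ^+ 2 * s i ^+ 2 / 2)))%:E)%E.
    rewrite integral_mkcond; apply: eq_integral => t _.
    rewrite big_split/= -hE patchE; case: (boolP (t \in _)) => [|/negP tC].
      by rewrite inE => tC; rewrite big1 ?mul1r// => i _; rewrite indicE mem_set.
    have [i tCi] : exists i, ~ C i (X i t).
      by apply/existsNP => H; apply: tC; rewrite inE.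
    by rewrite (bigD1 i)//= indicE memNset// !mul0r.
  rewrite (@expectation_prod_independent _ _ _ P I X
    (fun i y => \1_(C i) y * expR (a i * y - a i ^+ 2 * s i ^+ 2 / 2))
    (fun i => fine (P (Z i @^-1` C i))))//.
  - rewrite -prodEFin; apply: eq_big => [i|i _]; first by rewrite inE.
    by rewrite fineK// fin_num_measure.
  - move=> i; apply: measurable_funM; first exact: measurable_indic.
    by apply: measurableT_comp => //; exact: measurable_funB.
  - move=> i; rewrite fineK ?fin_num_measure//.
    by apply: integral_normal_tilt => //; exact: lawX.
(* Both sides are measures of [S], and [key] is their equality on rectangles. *)
apply: (@pushforward_unique _ _ _ _ _ (mdensity P _ mh h0) P _ _
  (@mx_rectangle _ R 1 #|I|)) => //.
- exact: g_sigma_mx_rectangle.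
- exact: mx_rectangleI.
- exact: mx_rectangleT.
- exact: measurable_family_row.
- exact: measurable_family_row.
- (* On the whole space, [key] bounds the total mass by 1. *)
  have := key (fun=> setT) (fun=> measurableT).
  have -> : [set t : T | forall i, [set: R] (X i t)] = setT.
    by apply/seteqP; split.
  by move=> E; rewrite [ltLHS]E (le_lt_trans (probability_le1 _ _)) ?ltry//;
    apply: (measurable_family_row I _ mXs setT).
move=> _ [B mB ->].
pose C i := B 0 (enum_rank i).
have CE (Z : I -> T -> R) : (fun t => family_row (Z^~ t)) @^-1`
    [set M : 'rV_#|I| | forall i j, B i j (M i j)] = [set t | forall i, C i (Z i t)].
  apply/seteqP; split => t /= H.
    by move=> i; have := H 0 (enum_rank i); rewrite mxE enum_rankK.
  move=> i j; rewrite mxE ord1; have := H (enum_val j).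
  by rewrite /C enum_valK.
rewrite (CE (fun i t => X i t + a i * s i ^+ 2)) CE.
by apply: key => i; exact: mB.
Qed.

(** * Pairs of independent GOE matrices *)

(** The entries on and above the diagonal, which index the independent entries
    of a symmetric matrix. *)
Notation upper n := {ij : 'I_n * 'I_n | (ij.1 <= ij.2)%N}.

(** The unordered pair [{i, j}] as an index on or above the diagonal. *)
Definition upper_pair {n : nat} (i j : 'I_n) : 'I_n * 'I_n :=
  if (i <= j)%N then (i, j) else (j, i).

Lemma upper_pairP {n : nat} (i j : 'I_n) :
  ((upper_pair i j).1 <= (upper_pair i j).2)%N.
Proof. by rewrite /upper_pair; case: ifP => //= /negbT; rewrite -ltnNge => /ltnW. Qed.

Definition to_upper {n : nat} (i j : 'I_n) : upper n :=
  exist _ (upper_pair i j) (upper_pairP i j).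

(** The symmetric matrix with given entries on and above the diagonal. *)
Definition sym_mx {R : realType} {n : nat} (u : upper n -> R) : 'M[R]_n :=
  \matrix_(i, j) u (to_upper i j).

Lemma sym_mxK {R : realType} {n : nat} (M : 'M[R]_n) :
  M^T = M -> sym_mx (fun k => M (val k).1 (val k).2) = M.
Proof.
move=> MT; apply/matrixP => i j; rewrite mxE /= /upper_pair.
by case: ifP => //= _; rewrite -[in LHS]MT mxE.
Qed.

(** The number of positions that an entry on or above the diagonal occupies in
    a symmetric matrix. *)
Definition upper_mult {R : realType} {n : nat} (k : upper n) : R :=
  if (val k).1 == (val k).2 then 1 else 2.

Lemma sum_upper {R : realType} {n : nat} (f : 'I_n -> 'I_n -> R) :
    (forall i j, f i j = f j i) ->
  \sum_(k : upper n) upper_mult k * f (val k).1 (val k).2 =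
  \sum_i \sum_j f i j.
Proof.
move=> fC; pose m (p : 'I_n * 'I_n) : R := if p.1 == p.2 then 1 else 2.
transitivity (\sum_(p : 'I_n * 'I_n | (p.1 <= p.2)%N) m p * f p.1 p.2).
  rewrite [RHS](reindex_omap (val : upper n -> _) insub) => [|p pP]/=; last first.
    by rewrite insubT.
  by apply: eq_bigl => k; rewrite (valP k) valK eqxx.
rewrite pair_big/= [RHS](bigID (fun p : 'I_n * 'I_n => (p.1 <= p.2)%N))/=.
have -> : \sum_(p : 'I_n * 'I_n | ~~ (p.1 <= p.2)%N) f p.1 p.2 =
    \sum_(p : 'I_n * 'I_n | (p.1 <= p.2)%N) (if p.1 == p.2 then 0 else f p.1 p.2).
  rewrite (reindex_inj (can_inj (@swap_pairK 'I_n 'I_n)))/=.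
  rewrite [RHS]big_mkcond [LHS]big_mkcond; apply: eq_bigr => -[i j] _ /=.
  rewrite -ltnNge; case: (ltngtP i j) => [ij|ij|/val_inj->]/=.
  - by rewrite fC ifF//; apply: contraTF ij => /eqP->; rewrite ltnn.
  - by [].
  - by rewrite !eqxx.
rewrite -big_split/=; apply: eq_bigr => p _; rewrite /m.
by case: ifP => _; ring.
Qed.

(** The Frobenius inner product. *)
Definition mxdot {R : realType} {n : nat} (M N : 'M[R]_n) : R :=
  \sum_i \sum_j M i j * N i j.

Lemma mxdot_upper {R : realType} {n : nat} (M N : 'M[R]_n) :
    M^T = M -> N^T = N ->
  mxdot M N = \sum_(k : upper n)
    upper_mult k * (M (val k).1 (val k).2 * N (val k).1 (val k).2).
Proof.
move=> MT NT; rewrite (sum_upper (fun i j => M i j * N i j))// => i j.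
by rewrite -[in LHS]MT -[in LHS]NT !mxE.
Qed.

Section goe_pair.
Context {d : measure_display} {T : measurableType d} {R : realType}.
Variables (P : probability T R) (n : nat) (W W' : {RV P >-> 'M[R]_n}).
Hypotheses (n_gt0 : (0 < n)%N) (goeW : GOE W) (goeW' : GOE W')
  (WW' : independent_RV W W').

(** The independent entries of a pair of independent GOE matrices. *)
Definition pair_entry (A A' : 'M[R]_n) (i : upper n + upper n) : R :=
  match i with
  | inl k => A (val k).1 (val k).2
  | inr k => A' (val k).1 (val k).2
  end.

(** The standard deviations of these entries. *)
Definition goe_sigma (k : upper n) : R :=
  Num.sqrt ((if (val k).1 == (val k).2 then 2 else 1) / n%:R).

Let nR_gt0 : 0 < n%:R :> R. Proof. by rewrite ltr0n. Qed.

Let goe_var_gt0 (k : upper n) :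
  0 < (if (val k).1 == (val k).2 then 2 else 1) / n%:R :> R.
Proof. by rewrite divr_gt0//; case: ifP. Qed.

Lemma goe_sigma_neq0 k : goe_sigma k != 0.
Proof. by rewrite gt_eqF// sqrtr_gt0. Qed.

Lemma sqr_goe_sigma k :
  goe_sigma k ^+ 2 = (if (val k).1 == (val k).2 then 2 else 1) / n%:R.
Proof. by rewrite sqr_sqrtr// ltW. Qed.

Lemma GOE_entry_law (V : {RV P >-> 'M[R]_n}) (k : upper n) (B : set R) :
    GOE V -> measurable B ->
  P ((fun t => V t (val k).1 (val k).2) @^-1` B) = normal_prob 0 (goe_sigma k) B.
Proof.
case: k => -[i j] /= ij; rewrite /goe_sigma /= => -[_ _ diag off] mB.
case: eqP ij => [->|/eqP ne] ij; first exact: diag.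
by apply: off => //; rewrite ltn_neqAle ij andbT.
Qed.

Lemma measurable_RV_entry (V : {RV P >-> 'M[R]_n}) i j :
  measurable_fun setT (fun t => V t i j).
Proof.
apply: (measurableT_comp (measurable_mx_coord n n i j)); exact: measurable_funPT.
Qed.

Lemma measurable_pair_entry i :
  measurable_fun setT (fun t => pair_entry (W t) (W' t) i).
Proof. by case: i => k; exact: measurable_RV_entry. Qed.

Lemma pair_entry_law i (B : set R) : measurable B ->
  P ((fun t => pair_entry (W t) (W' t) i) @^-1` B) =
  normal_prob 0 (match i with inl k => goe_sigma k | inr k => goe_sigma k end) B.
Proof. by case: i => k mB; exact: GOE_entry_law. Qed.

Lemma pair_entry_independent :
  mutually_independent P (fun i t => pair_entry (W t) (W' t) i).
Proof.
move=> J B mB.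
pose rect (f : upper n -> upper n + upper n) :=
  [set A : 'M[R]_n | forall k, f k \in J -> B (f k) (A (val k).1 (val k).2)].
have rectE f : rect f = \bigcap_(k in [set k | f k \in J])
    (fun A : 'M[R]_n => A (val k).1 (val k).2) @^-1` B (f k).
  by [].
have mrect f : measurable (rect f).
  rewrite rectE; apply: fin_bigcap_measurable => [|k _]; first exact: finite_finset.
  by rewrite -[X in measurable X]setTI; exact: measurable_mx_coord.
have -> : \bigcap_(i in [set` J])
      ((fun t => pair_entry (W t) (W' t) i) @^-1` B i) =
    (W @^-1` rect inl) `&` (W' @^-1` rect inr).
  apply/seteqP; split => t.
    by move=> H; split => k kJ; [exact: (H (inl k))|exact: (H (inr k))].
  by case=> H H' [k|k] kJ; [exact: H|exact: H'].
rewrite WW'// big_sumType/=.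
have part (V : {RV P >-> 'M[R]_n}) f : GOE V ->
    P (V @^-1` rect f) = (\prod_(k | f k \in J)
      P ((fun t => V t (val k).1 (val k).2) @^-1` B (f k)))%E.
  move=> [_ indV _ _].
  have := indV [set k | f k \in J]%SET (fun k => B (f k)) (fun k => mB (f k)).
  under [RHS]eq_bigl do rewrite inE.
  move=> <-; congr (P _); apply/seteqP; split => t H k.
    by rewrite /= inE; exact: H.
  by move=> kJ; apply: (H k); rewrite /= inE.
by rewrite !part.
Qed.

(** Weighting the law of two independent GOE matrices by the exponential of the
    inner products with symmetric matrices [M] and [M'] translates them by
    multiples of [M] and [M']. *)
Lemma GOE_pair_tilt (M M' : 'M[R]_n) (S : set ('M[R]_n * 'M[R]_n)) :
    M^T = M -> M'^T = M' -> measurable S ->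
  (\int[P]_(t in (fun t => (W t, W' t)) @^-1` S)
     (expR (mxdot M (W t) + mxdot M' (W' t)))%:E =
   (expR ((mxdot M M + mxdot M' M') / n%:R))%:E *
   P ((fun t => (W t + (2 / n%:R) *: M, W' t + (2 / n%:R) *: M')%R) @^-1` S))%E.
Proof.
move=> MT MT' mS.
have [WT _ _ _] := goeW; have [WT' _ _ _] := goeW'.
pose s (i : upper n + upper n) :=
  match i with inl k => goe_sigma k | inr k => goe_sigma k end.
pose a (i : upper n + upper n) := match i with
  | inl k => upper_mult k * M (val k).1 (val k).2
  | inr k => upper_mult k * M' (val k).1 (val k).2 end.
(* [F inl] and [F inr] rebuild the two matrices from their independent entries. *)
pose F (f : upper n -> upper n + upper n) (xi : 'rV[R]_#|{: upper n + upper n}|) :=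
  sym_mx (fun k => xi 0 (enum_rank (f k))).
have FE f (u : upper n + upper n -> R) :
    F f (family_row u) = sym_mx (fun k => u (f k)).
  by apply/matrixP => i j; rewrite !mxE enum_rankK.
have mF f : measurable_fun setT (F f).
  apply: measurable_mxP => i j.
  rewrite (_ : (fun xi => _) =
      fun xi : 'rV[R]_#|{: upper n + upper n}| =>
        xi 0 (enum_rank (f (to_upper i j)))); first exact: measurable_mx_coord.
  by apply/funext => xi; rewrite mxE.
have mFS : measurable ((fun xi => (F inl xi, F inr xi)) @^-1` S).
  by rewrite -[X in measurable X]setTI; apply: measurable_fun_pair.
have s0 i : s i != 0 by case: i => k; exact: goe_sigma_neq0.
have CM := cameron_martin P _ (fun i t => pair_entry (W t) (W' t) i) s a _ s0
  measurable_pair_entry pair_entry_independent pair_entry_law mFS.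
pose c := (mxdot M M + mxdot M' M') / n%:R.
(* The variance of an entry is inversely proportional to its multiplicity, so
   that the quadratic term is a Frobenius norm. *)
have half (N V : 'M[R]_n) : N^T = N -> V^T = V ->
    \sum_(k : upper n) (upper_mult k * N (val k).1 (val k).2 * V (val k).1 (val k).2
      - (upper_mult k * N (val k).1 (val k).2) ^+ 2 * goe_sigma k ^+ 2 / 2) =
    mxdot N V - mxdot N N / n%:R.
  move=> NT VT; rewrite (mxdot_upper N V)// (mxdot_upper N N)//.
  rewrite mulr_suml -sumrB; apply: eq_bigr => k _.
  rewrite sqr_goe_sigma /upper_mult.
  by case: ifP => _; field; rewrite lt0r_neq0.
have expE t : \sum_i (a i * pair_entry (W t) (W' t) i - a i ^+ 2 * s i ^+ 2 / 2) =
    mxdot M (W t) + mxdot M' (W' t) - c.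
  by rewrite big_sumType/= !half// /c mulrDl; ring.
(* For the same reason, the translation is a multiple of the matrix [N]. *)
have shiftE (N V : 'M[R]_n) : N^T = N -> V^T = V ->
    sym_mx (fun k => V (val k).1 (val k).2 +
      upper_mult k * N (val k).1 (val k).2 * goe_sigma k ^+ 2) =
    V + (2 / n%:R) *: N.
  move=> NT VT; rewrite -[RHS]sym_mxK; last first.
    by rewrite linearD/= linearZ/= NT VT.
  congr sym_mx; apply/funext => k; rewrite !mxE sqr_goe_sigma /upper_mult.
  by case: ifP => _; field; rewrite lt0r_neq0.
rewrite -/c (_ : (fun t => (W t + _, _)) @^-1` S =
    (fun t => family_row (fun i => pair_entry (W t) (W' t) i + a i * s i ^+ 2)) @^-1`
    ((fun xi => (F inl xi, F inr xi)) @^-1` S)); last first.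
  by apply/seteqP; split => t /=; rewrite !FE/= !shiftE.
rewrite -CM (_ : (fun t => (W t, W' t)) @^-1` S =
    (fun t => family_row (pair_entry (W t) (W' t))) @^-1`
    ((fun xi => (F inl xi, F inr xi)) @^-1` S)); last first.
  by apply/seteqP; split => t /=; rewrite !FE/= !sym_mxK.
rewrite -ge0_integralZl_EFin//.
- by apply: eq_integral => t _; rewrite expE -EFinM -expRD subrKC.
- rewrite -[X in measurable X]setTI.
  exact: (measurable_family_row _ _ measurable_pair_entry).
- apply/measurable_EFinP/measurable_funTS/measurableT_comp => //.
  apply: measurable_sum => i; apply: measurable_funB => //.
  by apply: measurable_funM => //; exact: measurable_pair_entry.
Qed.

End goe_pair.

Lemma mxdotDr {R : realType} {n : nat} (M N V : 'M[R]_n) :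
  mxdot M (N + V) = mxdot M N + mxdot M V.
Proof.
rewrite /mxdot -big_split; apply: eq_bigr => i _; rewrite -big_split.
by apply: eq_bigr => j _; rewrite mxE mulrDr.
Qed.

Lemma mxdotZr {R : realType} {n : nat} (M N : 'M[R]_n) a :
  mxdot M (a *: N) = a * mxdot M N.
Proof.
rewrite /mxdot mulr_sumr; apply: eq_bigr => i _; rewrite mulr_sumr.
by apply: eq_bigr => j _; rewrite mxE mulrCA.
Qed.

Lemma mxdotC {R : realType} {n : nat} (M N : 'M[R]_n) : mxdot M N = mxdot N M.
Proof. by apply: eq_bigr => i _; apply: eq_bigr => j _; rewrite mulrC. Qed.

Lemma mxdotDl {R : realType} {n : nat} (M N V : 'M[R]_n) :
  mxdot (M + N) V = mxdot M V + mxdot N V.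
Proof. by rewrite ![mxdot _ V]mxdotC mxdotDr. Qed.

Lemma mxdotZl {R : realType} {n : nat} (M N : 'M[R]_n) a :
  mxdot (a *: M) N = a * mxdot M N.
Proof. by rewrite ![mxdot _ N]mxdotC mxdotZr. Qed.

Lemma measurable_mxdot {d : measure_display} {T : measurableType d}
    {R : realType} {n : nat} (M : 'M[R]_n) (V : T -> 'M[R]_n) :
    (forall i j, measurable_fun setT (fun t => V t i j)) ->
  measurable_fun setT (fun t => mxdot M (V t)).
Proof.
move=> mV; apply: measurable_sum => i; apply: measurable_sum => j.
exact: measurable_funM.
Qed.

Lemma measurable_RV_addmx {d : measure_display} {T : measurableType d}
    {R : realType} (P : probability T R) (n : nat) (V : {RV P >-> 'M[R]_n})
    (M : 'M[R]_n) :
  measurable_fun setT (fun t => V t + M).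
Proof.
apply: measurable_mxP => i j.
rewrite (_ : (fun t => _) = (fun t => V t i j + M i j)).
  by apply: measurable_funD => //; exact: measurable_RV_entry.
by apply/funext => t; rewrite mxE.
Qed.

Lemma measurable_pair_stat_event {d : measure_display} {T : measurableType d}
    {R : realType} (P : probability T R) (n : nat) (W W' : {RV P >-> 'M[R]_n})
    (M : 'M[R]_n) (q e u : R) (S : set ('M[R]_n * 'M[R]_n)) :
    measurable S ->
  measurable [set t | S (W t, W' t) /\ u <= mxdot M (q *: (W t + e *: W' t))].
Proof.
move=> mS; apply: measurableI.
  rewrite -[X in measurable X]setTI.
  by apply: measurable_fun_pair => //; exact: measurable_funPT.
have mL : measurable_fun setT (fun t => mxdot M (q *: (W t + e *: W' t))).
  apply: measurable_mxdot => i j.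
  rewrite (_ : (fun t => _) = (fun t => q * (W t i j + e * W' t i j))).
    apply: measurable_funM => //; apply: measurable_funD.
      exact: measurable_RV_entry.
    by apply: measurable_funM => //; exact: measurable_RV_entry.
  by apply/funext => t; rewrite !mxE.
rewrite [X in measurable X](_ : _ = setT `&`
    (fun t => mxdot M (q *: (W t + e *: W' t))) @^-1` `[u, +oo[).
  exact: mL.
by rewrite setTI; apply/seteqP; split => t /=; rewrite in_itv/= andbT.
Qed.

(** Chernoff bound for a linear statistic of [(W + e W') / sqrt 2], where [e] is
    a sign, jointly with an event [S] that is invariant under the translations of
    [(W, W')] by multiples of [(M, e M)]. For [e = -1] and an event about
    [W + W'], this is where the independence of [W + W'] and [W - W'] is used. *)
Lemma GOE_pair_chernoff {d : measure_display} {T : measurableType d}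
    {R : realType} (P : probability T R) (n : nat) (W W' : {RV P >-> 'M[R]_n})
    (M : 'M[R]_n) (e u N : R) (S : set ('M[R]_n * 'M[R]_n)) :
    (0 < n)%N -> GOE W -> GOE W' -> independent_RV W W' ->
    M^T = M -> e ^+ 2 = 1 -> measurable S ->
    (forall c A A', S (A + c *: M, A' + (c * e) *: M) -> S (A, A')) ->
    0 < u -> 0 < N -> mxdot M M <= N ->
  (P [set t | S (W t, W' t) /\
              (u <= mxdot M ((Num.sqrt 2)^-1 *: (W t + e *: W' t)))%R]
   <= (expR (- (u ^+ 2 * n%:R / (4 * N))))%:E
      * P ((fun t => (W t, W' t)) @^-1` S))%E.
Proof.
move=> n_gt0 goeW goeW' WW' MT e2 mS Sinv u0 N0 MN.
have nR : 0 < n%:R :> R by rewrite ltr0n.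
(* This value of [th] minimizes [th ^+ 2 * N / n - th * u]. *)
pose th := u * n%:R / (2 * N).
have th0 : 0 < th by rewrite divr_gt0 ?mulr_gt0.
pose q : R := (Num.sqrt 2)^-1.
have q2 : q ^+ 2 = 2^-1 by rewrite exprVn sqr_sqrtr.
pose E := (fun t => (W t, W' t)) @^-1` S.
have mWW' : measurable_fun setT (fun t => (W t, W' t)).
  by apply: measurable_fun_pair; exact: measurable_funPT.
have mE : measurable E by rewrite -[X in measurable X]setTI; exact: mWW'.
pose L t := mxdot M (q *: (W t + e *: W' t)).
have LE t : th * L t = mxdot ((th * q) *: M) (W t) + mxdot ((th * q * e) *: M) (W' t).
  by rewrite /L mxdotZr mxdotDr mxdotZr !mxdotZl; ring.
have mL : measurable_fun setT L.
  rewrite (_ : L = fun t => th^-1 *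
      (mxdot ((th * q) *: M) (W t) + mxdot ((th * q * e) *: M) (W' t))).
    apply: measurable_funM => //; apply: measurable_funD;
      by apply: measurable_mxdot => i j; exact: measurable_RV_entry.
  by apply/funext => t; rewrite -LE mulKf// gt_eqF.
have mEu : measurable (E `&` [set t | u <= L t]).
  exact: measurable_pair_stat_event.
have mexp D : measurable_fun D (fun t => (expR (th * L t))%:E).
  apply/measurable_EFinP/measurable_funTS/measurableT_comp => //.
  exact: measurable_funM.
rewrite (_ : [set t | _] = E `&` [set t | u <= L t])//.
have step1 : ((expR (th * u))%:E * P (E `&` [set t | (u <= L t)%R]) <=
    \int[P]_(t in E) (expR (th * L t))%:E)%E.
  apply: (@le_trans _ _
      (\int[P]_(t in E `&` [set t | (u <= L t)%R]) (expR (th * L t))%:E)%E).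
    rewrite -integral_cst//; apply: ge0_le_integral => //.
    - by move=> t _; rewrite lee_fin /cst expR_ge0.
    - by move=> t [_ uL]; rewrite lee_fin ler_expR ler_pM2l.
  by apply: ge0_subset_integral => // t _; rewrite lee_fin expR_ge0.
have step2 : (\int[P]_(t in E) (expR (th * L t))%:E <=
    (expR (th ^+ 2 * N / n%:R))%:E * P E)%E.
  under eq_integral do rewrite LE.
  rewrite (GOE_pair_tilt P n W W' n_gt0 goeW goeW' WW')//; last 2 first.
  - by rewrite linearZ/= MT.
  - by rewrite linearZ/= MT.
  apply: lee_pmul => //.
    rewrite lee_fin ler_expR ler_pM2r ?invr_gt0//.
    rewrite !mxdotZl !mxdotZr.
    have -> : th * q * (th * q * mxdot M M) + th * q * e * (th * q * e * mxdot M M)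
      = th ^+ 2 * mxdot M M * (q ^+ 2 * (1 + e ^+ 2)) by ring.
    by rewrite e2 q2 mulVf// mulr1 ler_pM2l// exprn_gt0.
  rewrite le_measure ?inE//.
    rewrite -[X in measurable X]setTI; apply: measurable_fun_pair => //;
      exact: measurable_RV_addmx.
  move=> t /= H; apply: (Sinv (2 / n%:R * (th * q))); move: H.
  by rewrite !scalerA !mulrA.
have -> : - (u ^+ 2 * n%:R / (4 * N)) = th ^+ 2 * N / n%:R - th * u.
  by rewrite /th; field; rewrite !lt0r_neq0.
have := le_trans step1 step2.
rewrite expRB EFinM -muleA muleCA -lee_pdivlMl ?expR_gt0// => /le_trans; apply.
Qed.

(** * Inner products and quadratic forms *)

(** The Euclidean inner product. *)
Definition vdot {R : realType} {n : nat} (v w : 'cV[R]_n) : R :=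
  \sum_i v i 0 * w i 0.

Lemma vdotC {R : realType} {n : nat} (v w : 'cV[R]_n) : vdot v w = vdot w v.
Proof. by apply: eq_bigr => i _; rewrite mulrC. Qed.

Lemma vdot_mulmx {R : realType} {n : nat} (v w : 'cV[R]_n) :
  v^T *m w = (vdot v w)%:M.
Proof.
apply/matrixP => i j; rewrite !ord1 !mxE eqxx mulr1n.
by apply: eq_bigr => k _; rewrite mxE.
Qed.

Lemma vdot_delta {R : realType} {n : nat} (j : 'I_n) (v : 'cV[R]_n) :
  vdot (delta_mx j 0) v = v j 0.
Proof.
rewrite /vdot (bigD1 j)//= mxE !eqxx mul1r big1 ?addr0// => i ij.
by rewrite mxE (negbTE ij) mul0r.
Qed.

Lemma mxdot_outer {R : realType} {n : nat} (v w : 'cV[R]_n) (M : 'M[R]_n) :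
  mxdot (v *m w^T) M = vdot v (M *m w).
Proof.
apply: eq_bigr => i _; rewrite mxE mulr_sumr; apply: eq_bigr => j _.
by rewrite mxE big_ord1 mxE; ring.
Qed.

Lemma mxdot_outer2 {R : realType} {n : nat} (a b c d : 'cV[R]_n) :
  mxdot (a *m b^T) (c *m d^T) = vdot a c * vdot b d.
Proof.
rewrite mxdot_outer -mulmxA vdot_mulmx mul_mx_scalar [vdot b d]vdotC.
rewrite /vdot mulrC mulr_sumr; apply: eq_bigr => i _.
by rewrite mxE; ring.
Qed.

Lemma quad_formE {R : realType} {n : nat} (M : 'M[R]_n) (v : 'cV[R]_n) :
  quad_form M v = mxdot (v *m v^T) M.
Proof. by rewrite /quad_form mxdot_outer -mulmxA vdot_mulmx mxE eqxx mulr1n. Qed.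

(** * Ternary vectors *)

(** Vectors with entries in {-1, 0, 1}, indexed by a finite type. *)
Definition ternary {R : realType} {n : nat} (u : {ffun 'I_n -> option bool}) :
    'cV[R]_n :=
  \col_i (if u i is Some b then (if b then 1 else -1) else 0).

Lemma ternary_inj {R : realType} {n : nat} : injective (@ternary R n).
Proof.
move=> u u' uu'; apply/ffunP => i; have /matrixP/(_ i 0) := uu'; rewrite !mxE.
have h1 : (1 : R) != 0 by rewrite oner_eq0.
have h2 : (-1 : R) != 0 by rewrite oppr_eq0 oner_eq0.
have h3 : (1 : R) != -1 by rewrite gt_eqF//; lra.
by case: (u i) => [[]|]; case: (u' i) => [[]|] // /eqP;
  rewrite ?(negbTE h1) ?(negbTE h2) ?(negbTE h3) //
    eq_sym ?(negbTE h1) ?(negbTE h2) ?(negbTE h3).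
Qed.

Lemma supp_ternary {R : realType} {n : nat} (u : {ffun 'I_n -> option bool}) :
  supp (@ternary R n u) = [set i | isSome (u i)]%SET.
Proof.
apply/setP => i; rewrite !inE mxE.
by case: (u i) => [[]|]; rewrite ?oppr_eq0 ?oner_eq0 ?eqxx.
Qed.

Lemma ternary_vectorsP {R : realType} {n : nat} (l : nat) (v : 'cV[R]_n) :
  ternary_vectors l v <->
  exists2 u : {ffun 'I_n -> option bool}, v = ternary u & #|supp (@ternary R n u)| == l.
Proof.
split=> [[v3 vl]|[u -> /eqP ul]]; last first.
  split=> // i; rewrite mxE !inE.
  by case: (u i) => [[]|]; rewrite eqxx ?orbT.
pose u := [ffun i => if v i 0 == 0 then None else Some (v i 0 == 1)].
have vu : v = ternary u.
  apply/matrixP => i j; rewrite ord1 mxE ffunE; have := v3 i.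
  rewrite !inE => /or3P[] /eqP ->; rewrite ?eqxx ?oppr_eq0 ?oner_eq0//.
  by rewrite lt_eqF//; lra.
by exists u => //; rewrite -vu; exact/eqP.
Qed.

(** Each ternary vector of support size [l] is determined by a list of [l]
    positions and signs. *)
Lemma card_ternary (R : realType) (n l : nat) :
  (#|[set u : {ffun 'I_n -> option bool} | #|supp (@ternary R n u)| == l]%SET| <=
   (2 * n) ^ l)%N.
Proof.
(* [G f] has at [i] the sign that the list [f] attaches to position [i]. *)
pose G (f : {ffun 'I_l -> 'I_n * bool}) : {ffun 'I_n -> option bool} :=
  [ffun i => omap (fun k => (f k).2) [pick k | (f k).1 == i]].
have <- : #|[set: {ffun 'I_l -> 'I_n * bool}]%SET| = ((2 * n) ^ l)%N.
  by rewrite cardsT card_ffun card_prod card_ord card_bool card_ord mulnC.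
apply: leq_trans (leq_imset_card G _); apply: subset_leq_card.
apply/fintype.subsetP => u; rewrite inE supp_ternary => /eqP ul.
have ul' : l = #|[set i | isSome (u i)]%SET| by [].
pose f := [ffun k : 'I_l => let i := enum_val (cast_ord ul' k) in
  (i, if u i is Some b then b else true)].
apply/imsetP; exists f; first by rewrite inE.
apply/ffunP => i; rewrite ffunE; case: pickP => [k /=|nok].
  rewrite ffunE/= => /eqP ki; rewrite ki.
  have := enum_valP (cast_ord ul' k); rewrite ki inE.
  by case: (u i).
case ui: (u i) => [b|//].
have iu : i \in [set i | isSome (u i)]%SET by rewrite inE ui.
have := nok (cast_ord (esym ul') (enum_rank_in iu i)).
by rewrite ffunE/= cast_ordKV enum_rankK_in// eqxx.
Qed.

Lemma vdot_ternary {R : realType} {n : nat} (l : nat) (v : 'cV[R]_n) :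
  ternary_vectors l v -> vdot v v = l%:R.
Proof.
move=> [v3 <-]; rewrite -sum1_card natr_sum [RHS]big_mkcond.
apply: eq_bigr => i _; rewrite inE; have := v3 i.
rewrite !inE => /or3P[] /eqP->; rewrite ?eqxx ?oppr_eq0 ?oner_eq0 ?mulr0//.
  by rewrite mulrNN mulr1.
by rewrite mulr1.
Qed.

(** * Thresholding a noisy multiple of the signal *)

Lemma exact_recovery_threshold {R : realType} {n : nat} (x g : 'cV[R]_n)
    (c tau : R) :
    0 < tau -> (forall j, `|g j 0| < tau) ->
    (forall j, j \in supp x -> 2 * tau <= `|c * x j 0|) ->
  exact_recovery x (\col_j (Num.sg (c * x j 0 + g j 0) *
    (tau < `|c * x j 0 + g j 0|)%R%:R)).
Proof.
move=> tau0 gtau xtau; set xbar := \col_j _.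
have sgE j : Num.sg (xbar j 0) = Num.sg c * Num.sg (x j 0).
  rewrite mxE; have [xj|xj] := eqVneq (x j 0) 0.
    by rewrite xj !mulr0 add0r sgr0 mulr0 ltNge ltW ?gtau//= mulr0 sgr0.
  have jx : j \in supp x by rewrite inE.
  have := xtau j jx; have := gtau j.
  rewrite -sgrM; move: (c * x j 0) (g j 0) => y b bt yt.
  have ytau : tau < `|y + b|.
    have := lerB_normD y b; lra.
  rewrite ytau mulr1 sgr_id.
  have [y0|y0|y0] := ltrgt0P y.
  - rewrite !gtr0_sg//; move: yt bt; rewrite ltr_norml gtr0_norm// => ? /andP[]; lra.
  - rewrite !ltr0_sg//; move: yt bt; rewrite ltr_norml ltr0_norm// => ? /andP[]; lra.
  - by move: yt; rewrite y0 normr0; lra.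
(* If [x] is not zero, then [c] is not zero and decides the global sign. *)
have [x0|[j0 j0x]] := set_0Vmem (supp x).
  have x0j j : x j 0 = 0.
    by apply/eqP/negPn; have /setP/(_ j) := x0; rewrite !inE => ->.
  have xbar0 j : xbar j 0 = 0.
    by apply/eqP; rewrite -sgr_eq0 sgE x0j sgr0 mulr0.
  split; first by apply/setP => j; rewrite !inE x0j xbar0.
  by left; apply/matrixP => j k; rewrite ord1 [LHS]mxE [RHS]mxE x0j xbar0.
have c0 : c != 0.
  apply: contraTneq (xtau _ j0x) => ->; rewrite mul0r normr0 -ltNge; lra.
split.
  by apply/setP => j; rewrite !inE -sgr_eq0 sgE mulf_eq0 !sgr_eq0 (negbTE c0).
have [c_lt0|c_gt0] := orP (lt_total c0); [right|left].
  by apply/matrixP => j k; rewrite ord1 [LHS]mxE sgE ltr0_sg// mulN1r !mxE.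
by apply/matrixP => j k; rewrite ord1 [LHS]mxE sgE gtr0_sg// mul1r mxE.
Qed.

Lemma exists_subset_card {I : finType} (S : {set I}) (l : nat) :
  (l <= #|S|)%N -> exists2 B : {set I}, B \subset S & #|B| = l.
Proof.
move=> lS; exists [set i in take l (enum S)]%SET.
  by apply/fintype.subsetP => i; rewrite inE => /mem_take; rewrite mem_enum.
rewrite cardsE; have /card_uniqP -> : uniq (take l (enum S)).
  by rewrite take_uniq// enum_uniq.
by rewrite size_takel// -cardE.
Qed.

(** The sign pattern of a sparse vector on part of its support is a ternary
    vector well correlated with it. *)
Lemma sparse_ternary_corr {R : realType} {n : nat} (rho A : R) (x : 'cV[R]_n)
    (l : nat) :
    sparse rho A x -> (l <= #|supp x|)%N ->
  exists2 v, ternary_vectors l v & l%:R / (A * Num.sqrt (rho * n%:R)) <= vdot v x.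
Proof.
move=> [_ _ xA] /exists_subset_card[B Bx Bl].
pose v : 'cV[R]_n := \col_i (if i \in B then Num.sg (x i 0) else 0).
have suppv : supp v = B.
  apply/setP => i; rewrite inE mxE; case: ifP => iB; last by rewrite eqxx.
  by have := fintype.subsetP Bx _ iB; rewrite inE sgr_eq0.
exists v.
  split; last by rewrite suppv.
  move=> i; rewrite mxE !inE; case: ifP => _; last by rewrite eqxx orbT.
  by case: sgrP; rewrite ?eqxx ?orbT.
rewrite -Bl -sum1_card natr_sum mulr_suml big_mkcond/=; apply: ler_sum => i _.
rewrite mxE; case: ifP => iB; last by rewrite mul0r.
rewrite -normrEsg; have /xA/andP[] := fintype.subsetP Bx _ iB.
by [].
Qed.

(** * Numerical estimates *)

Section numeric.
Context {R : realType}.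
Variables (n l : nat) (lambda A rho : R).
Hypotheses (n_gt0 : (0 < n)%N) (l_gt0 : (0 < l)%N) (l_le_n : (l <= n)%N)
  (lambda_gt0 : 0 < lambda) (A_ge1 : 1 <= A) (rho_gt0 : 0 < rho).
Hypothesis l_ge :
  338 * A ^+ 4 / lambda ^+ 2 * rho ^+ 2 * n%:R * ln n%:R <= l%:R.

(** The signal-to-noise ratio that governs the error probability. *)
Definition snr : R := lambda ^+ 2 / A ^+ 4 * (l%:R / (rho ^+ 2 * n%:R)).

Let nR : 0 < n%:R :> R. Proof. by rewrite ltr0n. Qed.
Let lR : 0 < l%:R :> R. Proof. by rewrite ltr0n. Qed.
Let l1 : 1 <= l%:R :> R. Proof. by rewrite ler1n. Qed.
Let A0 : 0 < A. Proof. exact: lt_le_trans ltr01 A_ge1. Qed.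

Lemma snr_gt0 : 0 < snr.
Proof. by rewrite /snr mulr_gt0 ?divr_gt0 ?mulr_gt0 ?exprn_gt0. Qed.

Lemma ln_le_snr : 338 * ln n%:R <= snr.
Proof.
have -> : 338 * ln n%:R = lambda ^+ 2 / A ^+ 4 *
    (338 * A ^+ 4 / lambda ^+ 2 * rho ^+ 2 * n%:R * ln n%:R / (rho ^+ 2 * n%:R)) :> R.
  by field; rewrite !lt0r_neq0.
by rewrite ler_pM2l ?divr_gt0 ?exprn_gt0// ler_pM2r ?invr_gt0 ?mulr_gt0 ?exprn_gt0.
Qed.

Lemma expR_snrE :
  expR (- (lambda ^+ 2 / (288 * A ^+ 4) * (l%:R / (rho ^+ 2 * n%:R)))) =
  expR (- (snr / 288)).
Proof. by rewrite /snr; congr (expR (- _)); field; rewrite !lt0r_neq0. Qed.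

Lemma expR_snr_le_powR : expR (- (snr / 288)) <= n%:R `^ (- (169 / 144)).
Proof.
rewrite /powR gt_eqF// ler_expR; have := ln_le_snr; lra.
Qed.

Lemma natr_le_expR_snr : n%:R <= expR (snr / 338) :> R.
Proof. by rewrite -[leLHS]lnK ?posrE// ler_expR; have := ln_le_snr; lra. Qed.

(** The union bound over ternary vectors: [s] is the gap between the signal parts
    of the quadratic forms of a well and a poorly correlated vector, and the
    exponent equals [9/256 * l * snr], while [(2 n) ^ l] is at most
    [2 exp (2/338 * l * snr)]. *)
Lemma card_ternary_tail (s : R) :
    s = 3 / 4 * (lambda / Num.sqrt 2) * l%:R ^+ 2 / (A ^+ 2 * (rho * n%:R)) ->
  ((2 * n) ^ l)%:R * expR (- (s ^+ 2 * n%:R / (4 * (2 * l%:R ^+ 2)))) <=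
  2 * expR (- (snr / 288)).
Proof.
move=> ->.
have -> : (3 / 4 * (lambda / Num.sqrt 2) * l%:R ^+ 2 / (A ^+ 2 * (rho * n%:R))) ^+ 2
     * n%:R / (4 * (2 * l%:R ^+ 2)) = 9 / 256 * (l%:R * snr).
  have s2 : Num.sqrt 2 != 0 :> R by rewrite gt_eqF// sqrtr_gt0.
  have -> : (3 / 4 * (lambda / Num.sqrt 2) * l%:R ^+ 2 / (A ^+ 2 * (rho * n%:R))) ^+ 2
     * n%:R / (4 * (2 * l%:R ^+ 2)) =
     (3 / 4 * lambda * l%:R ^+ 2 / (A ^+ 2 * (rho * n%:R))) ^+ 2 / (Num.sqrt 2) ^+ 2
     * n%:R / (4 * (2 * l%:R ^+ 2)).
    by field; rewrite s2 !lt0r_neq0.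
  by rewrite sqr_sqrtr// /snr; field; rewrite !lt0r_neq0.
(* For [n = 1], also [l = 1], which is why the factor 2 is needed. *)
have cnt : ((2 * n) ^ l <= 2 * n ^ (2 * l))%N.
  case: n n_gt0 l_le_n => [//|[|m]] _ l_le.
    by case: l l_gt0 l_le => [//|[|//]].
  apply: (@leq_trans ((m.+2 * m.+2) ^ l)%N).
    by rewrite leq_exp2r// leq_mul.
  by rewrite expnM -mulnn leq_pmull.
have : ((2 * n) ^ l)%:R <= 2 * expR (2 * l%:R * (snr / 338)) :> R.
  apply: (le_trans (_ : _ <= (2 * n ^ (2 * l))%:R)); first by rewrite ler_nat.
  rewrite natrM ler_pM2l// natrX -natrM expRM_natl.
  by rewrite lerXn2r ?nnegrE ?expR_ge0// natr_le_expR_snr.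
move=> /(ler_wpM2r (expR_ge0 (- (9 / 256 * (l%:R * snr))))) /le_trans; apply.
rewrite -[leLHS]mulrA -expRD ler_pM2l// ler_expR.
have : snr <= l%:R * snr by rewrite ler_peMl// ltW// snr_gt0.
rewrite (_ : 2 * l%:R * (snr / 338) = 2 / 338 * (l%:R * snr)); last by ring.
by move: snr_gt0 (l%:R * snr) => snr0 p; lra.
Qed.

(** The union bound over the noise entries: the exponent equals [snr / 128],
    while the factor [n] is at most [exp (snr / 338)]. *)
Lemma noise_tail (tau : R) :
    tau = lambda / Num.sqrt 2 * l%:R / (4 * A ^+ 2 * rho * n%:R) ->
  n%:R * (2 * expR (- (tau ^+ 2 * n%:R / (4 * l%:R)))) <= 2 * expR (- (snr / 288)).
Proof.
move=> ->.
have -> : (lambda / Num.sqrt 2 * l%:R / (4 * A ^+ 2 * rho * n%:R)) ^+ 2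
    * n%:R / (4 * l%:R) = snr / 128.
  have s2 : Num.sqrt 2 != 0 :> R by rewrite gt_eqF// sqrtr_gt0.
  have -> : (lambda / Num.sqrt 2 * l%:R / (4 * A ^+ 2 * rho * n%:R)) ^+ 2
    * n%:R / (4 * l%:R) = (lambda * l%:R / (4 * A ^+ 2 * rho * n%:R)) ^+ 2
    / Num.sqrt 2 ^+ 2 * n%:R / (4 * l%:R).
    by field; rewrite s2 !lt0r_neq0.
  by rewrite sqr_sqrtr// /snr; field; rewrite !lt0r_neq0.
rewrite mulrCA ler_pM2l//.
apply: (le_trans (ler_wpM2r (expR_ge0 _) natr_le_expR_snr)).
by rewrite -expRD ler_expR; have := snr_gt0; lra.
Qed.

End numeric.

(** * Statistics of the two noise matrices *)

Lemma independent_RV_addmx {d : measure_display} {T : measurableType d}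
    {R : realType} (P : probability T R) (n : nat) (Y W W' : {RV P >-> 'M[R]_n})
    (M : 'M[R]_n) :
    (forall t, Y t = W t + M) -> independent_RV Y W' -> independent_RV W W'.
Proof.
move=> YE YW' B C mB mC.
pose B' := (fun A : 'M[R]_n => A - M) @^-1` B.
have mB' : measurable B'.
  rewrite -[X in measurable X]setTI.
  suff : measurable_fun setT (fun A : 'M[R]_n => A - M) by apply.
  apply: measurable_mxP => i j.
  rewrite (_ : (fun A => _) = (fun A : 'M[R]_n => A i j - M i j)).
    by apply: measurable_funB => //; exact: measurable_mx_coord.
  by apply/funext => A; rewrite !mxE.
have -> : W @^-1` B = Y @^-1` B'.
  by apply/seteqP; split => t; rewrite /B'/= YE addrK.
exact: YW'.
Qed.

(** The matrix representing the linear form [V |-> (V v)_j] on symmetric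
    matrices. *)
Definition row_form {R : realType} {n : nat} (j : 'I_n) (v : 'cV[R]_n) : 'M[R]_n :=
  2^-1 *: (delta_mx j 0 *m v^T + v *m (delta_mx j (0 : 'I_1))^T).

Lemma tr_row_form {R : realType} {n : nat} (j : 'I_n) (v : 'cV[R]_n) :
  (row_form j v)^T = row_form j v.
Proof. by rewrite linearZ/= linearD/= !trmx_mul !trmxK addrC. Qed.

Lemma mxdot_row_form {R : realType} {n : nat} (j : 'I_n) (v : 'cV[R]_n)
    (V : 'M[R]_n) :
  V^T = V -> mxdot (row_form j v) V = (V *m v) j 0.
Proof.
move=> VT; rewrite mxdotZl mxdotDl !mxdot_outer vdot_delta.
have -> : vdot v (V *m delta_mx j 0) = (V *m v) j 0.
  rewrite /vdot mxE; apply: eq_bigr => i _; rewrite -colE mxE mulrC.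
  by rewrite -[in LHS]VT mxE.
by field.
Qed.

Lemma mxdot_row_form_le {R : realType} {n : nat} (j : 'I_n) (v : 'cV[R]_n) :
  mxdot (row_form j v) (row_form j v) <= vdot v v.
Proof.
have vj : v j 0 ^+ 2 <= vdot v v.
  rewrite /vdot (bigD1 j)//= -expr2 lerDl sumr_ge0// => i _.
  by rewrite -expr2 sqr_ge0.
rewrite mxdotZl mxdotZr !mxdotDl !mxdotDr !mxdot_outer2.
rewrite [vdot v (delta_mx _ _)]vdotC !vdot_delta mxE !eqxx.
rewrite -!expr2 mul1r mulr1; move: vj; lra.
Qed.

Lemma tr_quad_diff {R : realType} {n : nat} (v w : 'cV[R]_n) :
  (v *m v^T - w *m w^T)^T = v *m v^T - w *m w^T.
Proof. by rewrite linearB/= !trmx_mul !trmxK. Qed.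

Lemma mxdot_quad_diff_le {R : realType} {n : nat} (v w : 'cV[R]_n) (a : R) :
    vdot v v = a -> vdot w w = a ->
  mxdot (v *m v^T - w *m w^T) (v *m v^T - w *m w^T) <= 2 * a ^+ 2.
Proof.
move=> va wa; rewrite -scaleN1r !mxdotDl !mxdotDr !mxdotZl !mxdotZr !mxdot_outer2.
rewrite va wa [vdot w v]vdotC; have := sqr_ge0 (vdot v w); lra.
Qed.

(** * Measurability of the recovery event *)

Lemma measurable_mx_set1 {R : realType} {m n : nat} (M : 'M[R]_(m, n)) :
  measurable [set M].
Proof.
apply: measurable_mx_rectangle; exists (fun i j => [set M i j]) => //.
by apply/seteqP; split => [_ ->//|N NM]; apply/matrixP.
Qed.

Lemma sg_itv {R : realType} (y : R) :
  Num.sg y = \1_(`]0, +oo[ : set R) y - \1_(`]-oo, 0[ : set R) y.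
Proof.
rewrite !indicE !mem_setE !in_itv/= andbT.
by case: sgrP => _; rewrite ?subrr ?subr0 ?sub0r.
Qed.

Lemma measurable_sg {R : realType} : measurable_fun setT (@Num.sg R).
Proof.
rewrite (_ : @Num.sg R = \1_(`]0, +oo[ : set R) \- \1_(`]-oo, 0[ : set R)).
  by apply: measurable_funB; exact: measurable_indic.
by apply/funext => y; rewrite sg_itv.
Qed.

Lemma measurable_mx_mulr {d : measure_display} {T : measurableType d}
    {R : realType} (m n : nat) (V : T -> 'M[R]_(m, n)) (v : T -> 'cV[R]_n) :
    measurable_fun setT V -> measurable_fun setT v ->
  measurable_fun setT (fun t => V t *m v t).
Proof.
move=> mV mv; apply: measurable_mxP => i j.
rewrite (_ : (fun t => _) = (fun t => \sum_k V t i k * v t k j)); last first.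
  by apply/funext => t; rewrite mxE.
apply: measurable_sum => k; apply: measurable_funM.
  exact: (measurableT_comp (measurable_mx_coord _ _ i k)).
exact: (measurableT_comp (measurable_mx_coord _ _ k j)).
Qed.

Lemma measurable_mx_lin {d : measure_display} {T : measurableType d}
    {R : realType} (m n : nat) (V V' : T -> 'M[R]_(m, n)) (a b : R) :
    measurable_fun setT V -> measurable_fun setT V' ->
  measurable_fun setT (fun t => a *: (V t + b *: V' t)).
Proof.
move=> mV mV'; apply: measurable_mxP => i j.
rewrite (_ : (fun t => _) = (fun t => a * (V t i j + b * V' t i j))); last first.
  by apply/funext => t; rewrite !mxE.
apply: measurable_funM => //; apply: measurable_funD.
  exact: (measurableT_comp (measurable_mx_coord _ _ i j)).
apply: measurable_funM => //.
exact: (measurableT_comp (measurable_mx_coord _ _ i j)).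
Qed.

Lemma measurable_exact_recovery {d : measure_display} {T : measurableType d}
    {R : realType} (n : nat) (x : 'cV[R]_n) (xbar : T -> 'cV[R]_n) :
    measurable_fun setT xbar ->
  measurable [set t | exact_recovery x (xbar t)].
Proof.
move=> mxbar.
have msg : measurable_fun setT (fun t => sign_vec (xbar t)).
  apply: measurable_mxP => i j.
  rewrite (_ : (fun t => _) = (fun t => Num.sg (xbar t i j))); last first.
    by apply/funext => t; rewrite mxE.
  apply: (measurableT_comp measurable_sg).
  exact: (measurableT_comp (measurable_mx_coord _ _ i j)).
have suppE (y : 'cV[R]_n) : supp (sign_vec y) = supp y.
  by apply/setP => i; rewrite !inE mxE sgr_eq0.
have suppN (y : 'cV[R]_n) : supp (- y) = supp y.
  by apply/setP => i; rewrite !inE mxE oppr_eq0.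
rewrite (_ : [set t | _] = (fun t => sign_vec (xbar t)) @^-1` [set sign_vec x] `|`
    (fun t => sign_vec (xbar t)) @^-1` [set - sign_vec x]).
  by apply: measurableU; rewrite -[X in measurable X]setTI; apply: msg => //;
    exact: measurable_mx_set1.
apply/seteqP; split => t /=; first by case.
case=> xE; split; rewrite ?xE; [|by left| |by right].
  by rewrite -suppE xE suppE.
by rewrite -suppE xE suppN suppE.
Qed.

Lemma measurable_wigner_recovery {d : measure_display} {T : measurableType d}
    {R : realType} (n : nat) (rho lambda A : R) (l : nat)
    (vstar : 'M[R]_n -> 'cV[R]_n) (Y W : T -> 'M[R]_n) :
    measurable_fun setT vstar -> measurable_fun setT Y -> measurable_fun setT W ->
  measurable_fun setT (fun t => wigner_recovery rho lambda A l vstar (Y t) (W t)).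
Proof.
move=> mvstar mY mW.
pose q : R := (Num.sqrt 2)^-1.
pose tau : R := lambda / Num.sqrt 2 * l%:R / (4 * A ^+ 2 * rho * n%:R).
pose z t := (q *: (Y t - W t)) *m vstar (q *: (Y t + W t)).
have mz : measurable_fun setT z.
  apply: measurable_mx_mulr.
    rewrite (_ : (fun t => _) = (fun t => q *: (Y t + (-1) *: W t))).
      exact: measurable_mx_lin.
    by apply/funext => t; rewrite scaleN1r.
  apply: measurableT_comp => //.
  rewrite (_ : (fun t => _) = (fun t => q *: (Y t + 1 *: W t))).
    exact: measurable_mx_lin.
  by apply/funext => t; rewrite scale1r.
apply: measurable_mxP => i j.
pose h (y : R) := Num.sg y * \1_(`]tau, +oo[ : set R) `|y|.
have mh : measurable_fun setT h.
  apply: measurable_funM; first exact: measurable_sg.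
  by apply: measurableT_comp.
rewrite (_ : (fun t => _) = h \o (fun t => z t i 0)); last first.
  by apply/funext => t; rewrite mxE/= /h indicE mem_setE in_itv/= andbT.
apply: measurableT_comp => //.
exact: (measurableT_comp (measurable_mx_coord _ _ i 0)).
Qed.

Lemma measure_le_sum {d : measure_display} {T : measurableType d} {R : realType}
    (P : {measure set T -> \bar R}) (I : finType) (p : pred I) (E : set T)
    (F : I -> set T) :
    measurable E -> (forall i, p i -> measurable (F i)) ->
    (forall t, E t -> exists2 i, p i & F i t) ->
  (P E <= \sum_(i | p i) P (F i))%E.
Proof.
move=> mE mF EF; rewrite bigfs ?index_enum_uniq//; last first.
  by move=> i _; rewrite mem_index_enum.
by apply: content_sub_fsum => // t /EF[i pi Fi]; exists i.
Qed.

Lemma sum_disjoint_le1 {d : measure_display} {T : measurableType d}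
    {R : realType} (P : probability T R) (I : finType) (p : pred I)
    (F : I -> set T) :
    (forall i, measurable (F i)) -> (forall i j t, F i t -> F j t -> i = j) ->
  (\sum_(i | p i) P (F i) <= 1)%E.
Proof.
move=> mF disj; rewrite bigfs ?index_enum_uniq//; last first.
  by move=> i _; rewrite mem_index_enum.
rewrite -measure_fin_bigcup//.
- by apply: probability_le1; apply: fin_bigcup_measurable.
- by move=> i j _ _ [t [Fi Fj]]; exact: disj Fi Fj.
Qed.

(** * The failure probability *)

Section failure_bound.
Context {d : measure_display} {T : measurableType d} {R : realType}.
Variables (P : probability T R) (n l : nat) (lambda A rho : R) (x : 'cV[R]_n)
  (W W' : {RV P >-> 'M[R]_n}) (vstar : 'M[R]_n -> 'cV[R]_n).
Hypotheses (n_gt0 : (0 < n)%N) (l_gt0 : (0 < l)%N) (l_le_supp : (l <= #|supp x|)%N)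
  (lambda_gt0 : 0 < lambda) (A_ge1 : 1 <= A) (rho_gt0 : 0 < rho)
  (x_sparse : sparse rho A x)
  (goeW : GOE W) (goeW' : GOE W') (WW' : independent_RV W W')
  (vstarP : argmax_selection l vstar)
  (l_ge : 338 * A ^+ 4 / lambda ^+ 2 * rho ^+ 2 * n%:R * ln n%:R <= l%:R).

Let q : R := (Num.sqrt 2)^-1.
Let K : R := rho * n%:R.
Let tau : R := lambda / Num.sqrt 2 * l%:R / (4 * A ^+ 2 * rho * n%:R).
Let s : R := 3 / 4 * (lambda / Num.sqrt 2) * l%:R ^+ 2 / (A ^+ 2 * K).
Let Y t := W t + lambda *: (x *m x^T).
Let v t := vstar (q *: (Y t + W' t)).

Let nR : 0 < n%:R :> R. Proof. by rewrite ltr0n. Qed.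
Let lR : 0 < l%:R :> R. Proof. by rewrite ltr0n. Qed.
Let A0 : 0 < A. Proof. exact: lt_le_trans ltr01 A_ge1. Qed.
Let q0 : 0 < q. Proof. by rewrite invr_gt0 sqrtr_gt0. Qed.
Let K0 : 0 < K. Proof. by rewrite mulr_gt0. Qed.
Let tau0 : 0 < tau.
Proof. by rewrite /tau !divr_gt0 ?mulr_gt0 ?exprn_gt0 ?invr_gt0 ?sqrtr_gt0. Qed.
Let s0 : 0 < s.
Proof. by rewrite /s !divr_gt0 ?mulr_gt0 ?exprn_gt0 ?invr_gt0 ?sqrtr_gt0 ?divr_gt0. Qed.

Let WT t : (W t)^T = W t. Proof. by case: goeW. Qed.
Let WT' t : (W' t)^T = W' t. Proof. by case: goeW'. Qed.

Lemma l_le_dim : (l <= n)%N.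
Proof. by rewrite (leq_trans l_le_supp)// (leq_trans (max_card _))// card_ord. Qed.

Lemma quad_form_spiked (w : 'cV[R]_n) t :
  quad_form (q *: (Y t + W' t)) w =
  mxdot (w *m w^T) (q *: (W t + 1 *: W' t)) + q * lambda * vdot w x ^+ 2.
Proof.
have -> : q *: (Y t + W' t) =
    q *: (W t + 1 *: W' t) + (q * lambda) *: (x *m x^T).
  by rewrite /Y scale1r -scalerA -scalerDr addrAC.
by rewrite quad_formE mxdotDr [mxdot _ ((q * _) *: _)]mxdotZr mxdot_outer2 expr2.
Qed.

(** Failure of the first stage: the noise makes up for the gap [s], which a
    vector poorly correlated with the signal needs to beat the reference vector
    [v0]. *)
Let F1 (v0 : 'cV[R]_n) (u : {ffun 'I_n -> option bool}) :=
  [set t | [set: 'M[R]_n * 'M[R]_n] (W t, W' t) /\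
    s <= mxdot (ternary u *m (ternary u)^T - v0 *m v0^T) (q *: (W t + 1 *: W' t))].

(** The values of the noise for which the first stage selects [ternary u]. They
    depend on the sum of the two matrices only. *)
Let sel u := [set AA : 'M[R]_n * 'M[R]_n |
  vstar (q *: (AA.1 + lambda *: (x *m x^T) + AA.2)) = ternary u].

(** Failure of the second stage: the first stage selects [ternary k.1], and the
    entry [k.2.1] of the noise, with sign [k.2.2], exceeds the threshold. *)
Let F2 (k : {ffun 'I_n -> option bool} * ('I_n * bool)) :=
  [set t | sel k.1 (W t, W' t) /\
    tau <= mxdot ((-1) ^+ k.2.2 *: row_form k.2.1 (ternary k.1))
             (q *: (W t + (-1) *: W' t))].

Lemma measurable_sel u : measurable (sel u).
Proof.
rewrite -[X in measurable X]setTI.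
suff : measurable_fun setT (fun AA : 'M[R]_n * 'M[R]_n =>
    vstar (q *: (AA.1 + lambda *: (x *m x^T) + AA.2))).
  by move=> H; exact: (H measurableT [set ternary u] (measurable_mx_set1 _)).
apply: measurableT_comp; first by case: vstarP.
rewrite (_ : (fun AA => _) = (fun AA : 'M[R]_n * 'M[R]_n =>
    q *: ((fun AA => 1 *: (AA.1 + lambda *: (cst (x *m x^T) AA))) AA + 1 *: AA.2))).
  by apply: measurable_mx_lin => //; exact: measurable_mx_lin.
by apply/funext => AA; rewrite /cst !scale1r.
Qed.

Lemma prob_F1_le v0 u : ternary_vectors l v0 -> ternary_vectors l (@ternary R n u) ->
  (P (F1 v0 u) <= (expR (- (s ^+ 2 * n%:R / (4 * (2 * l%:R ^+ 2)))))%:E)%E.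
Proof.
move=> v0l ul.
have := @GOE_pair_chernoff _ _ _ P n W W'
  (ternary u *m (ternary u)^T - v0 *m v0^T) 1 s (2 * l%:R ^+ 2) setT
  n_gt0 goeW goeW' WW'.
rewrite preimage_setT probability_setT mule1; apply => //.
- exact: tr_quad_diff.
- by rewrite expr1n.
- by rewrite mulr_gt0 ?exprn_gt0.
- by apply: mxdot_quad_diff_le; exact: vdot_ternary.
Qed.

Lemma prob_F2_le u j b : ternary_vectors l (@ternary R n u) ->
  (P (F2 (u, (j, b))) <= (expR (- (tau ^+ 2 * n%:R / (4 * l%:R))))%:E *
    P ((fun t => (W t, W' t)) @^-1` sel u))%E.
Proof.
move=> ul; apply: GOE_pair_chernoff => //.
- by rewrite linearZ/= tr_row_form.
- by rewrite sqrrN expr1n.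
- exact: measurable_sel.
- move=> c B B'; rewrite /sel/=.
  set M := _ *: row_form _ _.
  rewrite (_ : B + c *: M + _ + (B' + (c * -1) *: M) =
    B + lambda *: (x *m x^T) + B')//.
  by apply/matrixP => i k; rewrite !mxE; ring.
- rewrite mxdotZl mxdotZr mulrA -expr2 sqrr_sign mul1r -(vdot_ternary _ _ ul).
  exact: mxdot_row_form_le.
Qed.

(** Outside the two failure events, the selected vector has correlation at least
    [l / (2 A sqrt K)] with the signal, the signal part of the entries in the
    support is at least twice the threshold, and the noise is below it. *)
Lemma exact_recovery_cover v0 t : ternary_vectors l v0 ->
    l%:R / (A * Num.sqrt K) <= vdot v0 x ->
    ~ exact_recovery x (wigner_recovery rho lambda A l vstar (Y t) (W' t)) ->
  (exists2 u, #|supp (@ternary R n u)| == l & F1 v0 u t) \/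
  (exists2 k, #|supp (@ternary R n k.1)| == l & F2 k t).
Proof.
move=> v0l v0x nrec; apply: contrapT => nF; apply: nrec.
have [_ /(_ (q *: (Y t + W' t)))[vl vmax]] := vstarP.
rewrite -/(v t) in vl vmax.
have [u vu ul] := proj1 (ternary_vectorsP _ _) vl.
have stage1 : mxdot (v t *m (v t)^T - v0 *m v0^T) (q *: (W t + 1 *: W' t)) < s.
  rewrite ltNge; apply/negP => H; apply: nF; left; exists u => //.
  by split=> //; rewrite -vu.
have stage2 j (b : bool) : mxdot ((-1) ^+ b *: row_form j (v t))
    (q *: (W t + (-1) *: W' t)) < tau.
  rewrite ltNge; apply/negP => H; apply: nF; right; exists (u, (j, b)) => //.
  by split=> /=; [exact: vu|rewrite -vu].
pose g := (q *: (W t + (-1) *: W' t)) *m v t.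
have gtau j : `|g j 0| < tau.
  have gE : mxdot (row_form j (v t)) (q *: (W t + (-1) *: W' t)) = g j 0.
    by apply: mxdot_row_form; rewrite linearZ/= linearD/= linearZ/= WT WT'.
  rewrite ltr_norml -gE; apply/andP; split.
    by have := stage2 j true; rewrite mxdotZl expr1 mulN1r ltrNl.
  by have := stage2 j false; rewrite mxdotZl expr0 mul1r.
have sK0 : 0 < Num.sqrt K by rewrite sqrtr_gt0.
have sK2 : Num.sqrt K ^+ 2 = K by rewrite sqr_sqrtr// ltW.
pose r := l%:R / (A * Num.sqrt K).
have r0 : 0 < r by rewrite divr_gt0 ?mulr_gt0.
have r2 : r ^+ 2 = l%:R ^+ 2 / (A ^+ 2 * K) by rewrite expr_div_n exprMn sK2.
(* Otherwise [v0] would beat the maximizer [v t]. *)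
have corr : r / 2 <= `|vdot (v t) x|.
  rewrite leNgt; apply/negP => small.
  have vx2 : vdot (v t) x ^+ 2 < r ^+ 2 / 4.
    rewrite -real_normK ?num_real//.
    have -> : r ^+ 2 / 4 = (r / 2) ^+ 2 by field.
    by rewrite ltrXn2r// ?nnegrE ?divr_ge0// ltW.
  have v0x2 : r ^+ 2 <= vdot v0 x ^+ 2.
    by rewrite lerXn2r// nnegrE ?ltW// (lt_le_trans r0).
  have := vmax v0 v0l; rewrite !quad_form_spiked.
  move: stage1; rewrite -scaleN1r mxdotDl mxdotZl.
  have -> : s = q * lambda * (r ^+ 2 - r ^+ 2 / 4).
    by rewrite /s r2 /q; field; rewrite !lt0r_neq0 ?sqrtr_gt0.
  have : q * lambda * (r ^+ 2 - r ^+ 2 / 4) <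
      q * lambda * (vdot v0 x ^+ 2 - vdot (v t) x ^+ 2).
    by rewrite ltr_pM2l ?mulr_gt0//; lra.
  by rewrite !mulrBr; lra.
pose c := q * lambda * vdot (v t) x.
suff -> : wigner_recovery rho lambda A l vstar (Y t) (W' t) =
    \col_j (Num.sg (c * x j 0 + g j 0) * (tau < `|c * x j 0 + g j 0|)%R%:R).
  apply: exact_recovery_threshold => // j jx.
  have [_ _ /(_ j jx)/andP[xj _]] := x_sparse.
  rewrite normrM normrM gtr0_norm ?mulr_gt0//.
  have -> : 2 * tau = q * lambda * (r / 2) * (1 / (A * Num.sqrt K)).
    rewrite /tau /r /q.
    have -> : 4 * A ^+ 2 * rho * n%:R = 4 * A ^+ 2 * Num.sqrt K ^+ 2.
      by rewrite sK2 /K; ring.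
    by field; rewrite !lt0r_neq0 ?sqrtr_gt0.
  apply: ler_pM => //.
  - by rewrite ltW// mulr_gt0 ?divr_gt0// mulr_gt0.
  - by rewrite ltW// divr_gt0// mulr_gt0.
  - by rewrite ler_pM2l ?mulr_gt0.
apply/matrixP => j k; rewrite ord1 [LHS]mxE [RHS]mxE -/(v t).
suff -> : ((Num.sqrt 2)^-1 *: (Y t - W' t) *m v t) j 0 = c * x j 0 + g j 0 by [].
rewrite -/q.
have -> : q *: (Y t - W' t) =
    (q * lambda) *: (x *m x^T) + q *: (W t + (-1) *: W' t).
  by apply/matrixP => i i'; rewrite !mxE; ring.
rewrite mulmxDl -scalemxAl -mulmxA vdot_mulmx mul_mx_scalar vdotC -/g.
by rewrite mxE mxE mxE /c mulrA.
Qed.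

Lemma prob_failure_le :
  (P [set t | ~ exact_recovery x (wigner_recovery rho lambda A l vstar (Y t) (W' t))]
   <= (4 * expR (- (snr n l lambda A rho / 288)))%:E)%E.
Proof.
have [v0 v0l v0x] := sparse_ternary_corr _ _ _ _ x_sparse l_le_supp.
have mfail : measurable [set t | ~ exact_recovery x
    (wigner_recovery rho lambda A l vstar (Y t) (W' t))].
  apply: measurableC; apply: measurable_exact_recovery.
  apply: measurable_wigner_recovery; first by case: vstarP.
    exact: measurable_RV_addmx.
  exact: measurable_funPT.
pose I := ({ffun 'I_n -> option bool} +
           {ffun 'I_n -> option bool} * ('I_n * bool))%type.
pose p u := #|supp (@ternary R n u)| == l.
pose pI (i : I) := match i with inl u => p u | inr k => p k.1 end.
pose F (i : I) := match i with inl u => F1 v0 u | inr k => F2 k end.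
have pl u : p u -> ternary_vectors l (@ternary R n u).
  by move=> pu; apply/ternary_vectorsP; exists u.
apply: (le_trans (measure_le_sum P I pI _ F mfail _ _)).
- case=> [u|k] _.
    exact: measurable_pair_stat_event.
  by apply: measurable_pair_stat_event; exact: measurable_sel.
- move=> t /(exact_recovery_cover v0 t v0l v0x)[[u pu Fu]|[k pk Fk]].
    by exists (inl u).
  by exists (inr k).
rewrite big_sumType/=.
have -> : 4 * expR (- (snr n l lambda A rho / 288)) =
    2 * expR (- (snr n l lambda A rho / 288)) +
    2 * expR (- (snr n l lambda A rho / 288)) by ring.
rewrite EFinD; apply: leeD.
  apply: (@le_trans _ _ (\sum_(u | p u)
      (expR (- (s ^+ 2 * n%:R / (4 * (2 * l%:R ^+ 2)))))%:E)%E).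
    by apply: lee_sum => u pu; apply: prob_F1_le => //; exact: pl.
  rewrite sumEFin lee_fin sumr_const -[leLHS]mulr_natl.
  have := card_ternary_tail n l lambda A rho n_gt0 l_gt0 l_le_dim lambda_gt0
    A_ge1 rho_gt0 l_ge s erefl.
  apply: le_trans; rewrite ler_pM2r ?expR_gt0// ler_nat -cardsE.
  exact: card_ternary.
have -> : (\sum_(k | p k.1) P (F2 k) =
    \sum_(u | p u) \sum_(jb : 'I_n * bool) P (F2 (u, jb)))%E.
  by rewrite pair_big/=; apply: eq_big => -[u jb]//=; rewrite andbT.
have mV u : measurable ((fun t => (W t, W' t)) @^-1` sel u).
  rewrite -[X in measurable X]setTI.
  by apply: measurable_fun_pair => //; exact: measurable_sel.
pose e := expR (- (tau ^+ 2 * n%:R / (4 * l%:R))).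
(* The factor [2 n] counts the entries with their signs; the events [sel u] are
   disjoint, so that there is no union bound over [u] here. *)
apply: (@le_trans _ _ (\sum_(u | p u)
    (n%:R * (2 * e))%:E * P ((fun t => (W t, W' t)) @^-1` sel u))%E).
  apply: lee_sum => u pu.
  apply: (@le_trans _ _ (\sum_(jb : 'I_n * bool)
      e%:E * P ((fun t => (W t, W' t)) @^-1` sel u))%E).
    by apply: lee_sum => -[j b] _; apply: prob_F2_le; exact: pl.
  have fP : P ((fun t => (W t, W' t)) @^-1` sel u) \is a fin_num.
    exact: fin_num_measure.
  rewrite -(fineK fP) -!EFinM sumEFin lee_fin sumr_const card_prod card_ord card_bool.
  by rewrite -[leLHS]mulr_natr natrM; lra.
rewrite -ge0_sume_distrr//.
apply: (@le_trans _ _ ((n%:R * (2 * e))%:E * 1)%E).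
  apply: lee_wpmul2l; first by rewrite lee_fin !mulr_ge0 ?expR_ge0.
  apply: sum_disjoint_le1 => // u u' t tu tu'.
  exact: ternary_inj (etrans (esym tu) tu').
rewrite mule1 lee_fin.
exact: noise_tail n l lambda A rho n_gt0 l_gt0 lambda_gt0 A_ge1 rho_gt0 l_ge tau erefl.
Qed.

End failure_bound.

(* For n = 1 the factor 1 / log n is read as +oo, so the bound on rho is then
   no constraint (in the library, 1 / ln 1 = 0). *)
Theorem theorem2p21 (R : realType) (d : measure_display) (T : measurableType d)
    (P : probability T R) (n : nat) (lambda A rho : R) (x : 'cV[R]_n)
    (Y Wt : {RV P >-> 'M[R]_n})
    (n_gt0 : (0 < n)%N) (lambda_gt0 : 0 < lambda) (A_ge1 : 1 <= A)
    (rho_gt0 : 0 < rho) (rho_le1 : rho <= 1)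
    (rhon_int : rho * n%:R \is a Num.int)
    (x_sparse : sparse rho A x)
    (Y_law : spiked_wigner lambda x Y)
    (Wt_law : GOE Wt) (Y_Wt_indep : independent_RV Y Wt)
    (rho_small : (1 < n)%N ->
       rho <= lambda ^+ 2 / (338 * A ^+ 4) * (1 / ln n%:R)) :
  (exists l : nat, (0 < l)%N /\ l%:R \in ell_range n rho lambda A) /\
  forall (l : nat) (vstar : 'M[R]_n -> 'cV[R]_n),
    (0 < l)%N -> l%:R \in ell_range n rho lambda A ->
    argmax_selection l vstar ->
    (1 - P [set t | exact_recovery x
                      (wigner_recovery rho lambda A l vstar (Y t) (Wt t))]
       <= (4 * expR (- (lambda ^+ 2 / (288 * A ^+ 4)
                        * (l%:R / (rho ^+ 2 * n%:R)))))%:E)%E /\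
    4 * expR (- (lambda ^+ 2 / (288 * A ^+ 4) * (l%:R / (rho ^+ 2 * n%:R))))
      <= 4 * n%:R `^ (- (169 / 144)).
Proof.
have nR : 0 < n%:R :> R by rewrite ltr0n.
have A0 : 0 < A by exact: lt_le_trans ltr01 A_ge1.
have [_ cardx _] := x_sparse.
split.
  (* The right end point of the interval is the integer [#|supp x|]. *)
  exists #|supp x|; split; first by rewrite -(ltr0n R) cardx mulr_gt0.
  rewrite /ell_range cardx in_itv/= lexx andbT.
  have [n1|n1] := leqP n 1.
    have -> : n = 1%N by apply/eqP; rewrite eqn_leq n1.
    by rewrite ln1 mulr0 mulr1 ltW.
  have ln0 : 0 < ln n%:R :> R by rewrite ln_gt0// ltr1n.
  have c0 : 0 < lambda ^+ 2 / (338 * A ^+ 4) / ln n%:R.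
    by rewrite !divr_gt0 ?mulr_gt0 ?exprn_gt0.
  have -> : 338 * A ^+ 4 / lambda ^+ 2 * rho ^+ 2 * n%:R * ln n%:R =
      rho / (lambda ^+ 2 / (338 * A ^+ 4) / ln n%:R) * (rho * n%:R).
    by field; rewrite !lt0r_neq0.
  rewrite ler_piMl//; first by rewrite mulr_ge0// ltW.
  rewrite ler_pdivrMr// mul1r.
  by have := rho_small n1; rewrite div1r.
move=> l vstar l_gt0; rewrite /ell_range in_itv/= => /andP[l_ge l_le] vstarP.
have l_le_supp : (l <= #|supp x|)%N by rewrite -(ler_nat R) cardx.
rewrite (expR_snrE n l lambda A rho)//; split; last first.
  by rewrite ler_pM2l// expR_snr_le_powR.
have [W [W_law YE]] := Y_law.
have W_Wt : independent_RV W Wt by apply: independent_RV_addmx YE Y_Wt_indep.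
rewrite -probability_setC; last first.
  apply: measurable_exact_recovery; apply: measurable_wigner_recovery => //.
    by case: vstarP.
have := prob_failure_le P n l lambda A rho x W Wt vstar n_gt0 l_gt0 l_le_supp
  lambda_gt0 A_ge1 rho_gt0 x_sparse W_law Wt_law W_Wt vstarP l_ge.
apply: le_trans; rewrite le_eqVlt; apply/orP; left; apply/eqP; congr (P _).
by apply/seteqP; split => t /=; rewrite YE.
Qed.
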